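(* Let $\rho:B\twoheadrightarrow\Gamma$ be a Fell bundle over an étale groupoid $\Gamma$. Then $(\mathcal{S}^\rho_{\mathsf b},\|\cdot\|_{\mathsf b})$ is a Banach space, where $\mathcal{S}^\rho_{\mathsf b}=\{a\in\mathcal{S}^\rho:\|a\|_{\mathsf b}<\infty\}$.
   Context: Groupoids. For a groupoid $\Gamma$, $\mathsf{s}(\gamma)=\gamma^{-1}\gamma$, $\mathsf{r}(\gamma)=\gamma\gamma^{-1}$, $\Gamma^0\subseteq\Gamma$ is the set of units, and $\Gamma^2$ is the set of composable pairs ($(\alpha,\beta)\in\Gamma^2$ iff $\mathsf{s}(\alpha)=\mathsf{r}(\beta)$). For $x\in\Gamma^0$, $\Gamma x=\{\gamma:\mathsf{s}(\gamma)=x\}$. An étale groupoid is a groupoid with a topology making product and inverse continuous and such that $\mathsf{s}$ is an open map. No Hausdorff, local compactness or countability assumption is made, even on $\Gamma^0$. Fell bundles. A semigroupoid is a set with a partial binary operation such that $(ab)c$ is defined iff $a(bc)$ is, in which case they are equal; a *-semigroupoid also has an involution with $a^{**}=a$ and $(ab)^*=b^*a^*$ whenever $ab$ is defined. A Banach bundle is an open continuous surjection $\rho:B\twoheadrightarrow X$ of topological spaces such that each fibre $B_x=\rho^{-1}\{x\}$ is a complex Banach space (zero $0_x$); for each $\lambda\in\mathbb{C}$, $b\mapsto\lambda b$ is continuous on $B$; addition is continuous on $\{(a,b):\rho(a)=\rho(b)\}$; the norm is upper semicontinuous on $B$; and $\rho(b_\lambda)\to x$, $\|b_\lambda\|\to0$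 imply $b_\lambda\to0_x$ for nets. A Fell bundle is a Banach bundle $\rho:B\twoheadrightarrow\Gamma$ such that: (1) $B$ is a *-semigroupoid with continuous product and involution, products are bilinear and $*$ is antilinear; (2) the norm is submultiplicative, $\Gamma$ is an étale groupoid, $ab$ is defined iff $(\rho(a),\rho(b))\in\Gamma^2$, in which case $\rho(ab)=\rho(a)\rho(b)$, and $\rho(a^* )=\rho(a)^{-1}$; (3) for all $b\in B$, $\|b^*b\|=\|b\|^2$ and there is $a\in B_{\rho(b^*b)}$ with $a^*a=b^*b$. Sections. $\mathcal{S}^\rho$ is the vector space (pointwise operations) of all, possibly discontinuous, sections $a:\Gamma\to B$, $\rho\circ a=\mathrm{id}_\Gamma$. Put $\mathrm{supp}(a)=\{\gamma:a(\gamma)\ne0_\gamma\}$. $\mathcal{F}^\rho$ denotes the finitely supported sections; for $a\in\mathcal{S}^\rho$, $f\in\mathcal{F}^\rho$ the convolution is $af(\gamma)=\sum_{\gamma=\alpha\beta}a(\alpha)f(\beta)$ (a finite sum). Define $[0,\infty]$-valued norms by $$\|a\|_2=\sup_{x\in\Gamma^0}\ \sup_{F\subseteq\Gamma x\text{ finite}}\Big\|\sum_{\gamma\in F}a(\gamma)^*a(\gamma)\Big\|^{1/2},\qquad \|a\|_{\mathsf b}=\sup_{f\in\mathcal{F}^\rho}\frac{\|af\|_2}{\|f\|_2}\quad(0/0=0).$$ *)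

(* Defs.v *)
From HB Require Import structures.
From mathcomp Require Import all_boot all_order all_algebra.
From mathcomp Require Import complex.
From mathcomp Require Import all_classical all_reals all_analysis.

Set Implicit Arguments.
Unset Strict Implicit.
Unset Printing Implicit Defensive.

Import Order.TTheory GRing.Theory Num.Theory.
Import numFieldNormedType.Exports.

Local Open Scope classical_set_scope.
Local Open Scope ring_scope.

(** Partial binary operations are total functions; their values outside the
    domain of definition are never constrained by an axiom. *)

Definition gsrc (G : Type) (mul : G -> G -> G) (inv : G -> G) (g : G) : G :=
  mul (inv g) g.

Definition grng (G : Type) (mul : G -> G -> G) (inv : G -> G) (g : G) : G :=
  mul g (inv g).

Definition gcomposable (G : Type) (mul : G -> G -> G) (inv : G -> G)
    (g h : G) : Prop :=
  gsrc mul inv g = grng mul inv h.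

(** One-sorted presentation of a small category in which every arrow is
    invertible: the objects are the units [gsrc g]. *)
Record isGroupoid (G : Type) (mul : G -> G -> G) (inv : G -> G) : Prop := {
  groupoid_invK : forall g, inv (inv g) = g ;
  groupoid_src_mul : forall g h, gcomposable mul inv g h ->
    gsrc mul inv (mul g h) = gsrc mul inv h ;
  groupoid_rng_mul : forall g h, gcomposable mul inv g h ->
    grng mul inv (mul g h) = grng mul inv g ;
  groupoid_mulA : forall g h k,
    gcomposable mul inv g h -> gcomposable mul inv h k ->
    mul (mul g h) k = mul g (mul h k) ;
  groupoid_mul_src : forall g, mul g (gsrc mul inv g) = g ;
  groupoid_mul_rng : forall g, mul (grng mul inv g) g = g
}.

(** The source map is open as a map from [G] to [G] (not merely onto the
    subspace of units). *)
Record etaleGroupoid := EtaleGroupoid {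
  etale_sort :> topologicalType ;
  gmul : etale_sort -> etale_sort -> etale_sort ;
  ginv : etale_sort -> etale_sort ;
  etale_groupoid : isGroupoid gmul ginv ;
  etale_mul_continuous :
    {within [set p : etale_sort * etale_sort | gcomposable gmul ginv p.1 p.2],
      continuous (fun p : etale_sort * etale_sort => gmul p.1 p.2)} ;
  etale_inv_continuous : continuous ginv ;
  etale_src_open : forall U : set etale_sort,
    open U -> open (gsrc gmul ginv @` U)
}.

Definition src (G : etaleGroupoid) : G -> G := gsrc (@gmul G) (@ginv G).

Definition composable (G : etaleGroupoid) : G -> G -> Prop :=
  gcomposable (@gmul G) (@ginv G).

Definition units (G : etaleGroupoid) : set G := range (@src G).
Arguments units G _ : clear implicits.

(** The fibre over [x] is a complex Banach space [fib x], identified with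
    [proj @^-1` [set x]] by [inc x]. *)
Record bundleData (R : realType) (X : topologicalType) := BundleData {
  tot : topologicalType ;
  proj : tot -> X ;
  fib : X -> completeNormedModType R[i] ;
  inc : forall x, fib x -> tot
}.

Section BundleOperations.
Context (R : realType) (X : topologicalType) (rho : bundleData R X).

(** The inverse of [inc x]; it is only meaningful on the fibre over [x]. *)
Definition coord (x : X) (b : tot rho) : fib rho x :=
  xget 0 [set v | inc v = b].

(** The norm of a normed module over [R[i]] is [R[i]]-valued; its imaginary
    part is zero. *)
Definition fnorm (x : X) (v : fib rho x) : R := complex.Re `|v|.

Definition bnorm (b : tot rho) : R := fnorm (coord (proj b) b).

Definition bzero (x : X) : tot rho := inc (0 : fib rho x).

Definition bscale (l : R[i]) (b : tot rho) : tot rho :=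
  inc (l *: coord (proj b) b).

(** Only meaningful when [proj a = proj b]. *)
Definition badd (a b : tot rho) : tot rho :=
  inc (coord (proj a) a + coord (proj a) b).

End BundleOperations.

(** In [bundle_null_cvg], filters play the role of nets. *)
Record isBanachBundle (R : realType) (X : topologicalType)
    (rho : bundleData R X) : Prop := {
  bundle_inc_inj : forall x, injective (@inc R X rho x) ;
  bundle_inc_range : forall x,
    range (@inc R X rho x) = @proj R X rho @^-1` [set x] ;
  bundle_proj_continuous : continuous (@proj R X rho) ;
  bundle_proj_open : forall U : set (tot rho),
    open U -> open (@proj R X rho @` U) ;
  bundle_proj_surj : range (@proj R X rho) = setT ;
  bundle_scale_continuous : forall l : R[i], continuous (@bscale R X rho l) ;
  bundle_add_continuous :
    {within [set p : tot rho * tot rho | proj p.1 = proj p.2],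
      continuous (fun p : tot rho * tot rho => badd p.1 p.2)} ;
  bundle_norm_usc : forall r : R, open [set b : tot rho | bnorm b < r] ;
  bundle_null_cvg : forall (x : X) (F : set_system (tot rho)),
    ProperFilter F ->
    @proj R X rho @ F --> x -> @bnorm R X rho @ F --> (0 : R) ->
    F --> bzero rho x
}.

Record banachBundle (R : realType) (X : topologicalType) := BanachBundle {
  bundle_data :> bundleData R X ;
  bundle_axioms : isBanachBundle bundle_data
}.

(** [def a b] means that the product [mul a b] is defined. *)
Record isSemigroupoid (S : Type) (def : S -> S -> Prop) (mul : S -> S -> S)
    : Prop := {
  semigroupoid_def : forall a b c,
    (def a b /\ def (mul a b) c) <-> (def b c /\ def a (mul b c)) ;
  semigroupoid_mulA : forall a b c,
    def a b -> def (mul a b) c -> mul (mul a b) c = mul a (mul b c)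
}.

Record isStarSemigroupoid (S : Type) (def : S -> S -> Prop)
    (mul : S -> S -> S) (star : S -> S) : Prop := {
  star_semigroupoid : isSemigroupoid def mul ;
  star_semigroupoidK : forall a, star (star a) = a ;
  star_semigroupoidM : forall a b, def a b ->
    def (star b) (star a) /\ star (mul a b) = mul (star b) (star a)
}.

Definition bdef (R : realType) (G : etaleGroupoid) (rho : bundleData R G)
    (a b : tot rho) : Prop :=
  composable (proj a) (proj b).

Record isFellBundle (R : realType) (G : etaleGroupoid) (rho : bundleData R G)
    (mul : tot rho -> tot rho -> tot rho) (star : tot rho -> tot rho)
    : Prop := {
  fell_star_semigroupoid : isStarSemigroupoid (@bdef R G rho) mul star ;
  fell_mul_continuous :
    {within [set p : tot rho * tot rho | bdef p.1 p.2],
      continuous (fun p : tot rho * tot rho => mul p.1 p.2)} ;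
  fell_star_continuous : continuous star ;
  fell_proj_mul : forall a b, bdef a b ->
    proj (mul a b) = gmul (proj a) (proj b) ;
  fell_proj_star : forall a, proj (star a) = ginv (proj a) ;
  fell_mulDl : forall a b c, proj a = proj b -> bdef a c ->
    mul (badd a b) c = badd (mul a c) (mul b c) ;
  fell_mulDr : forall a b c, proj b = proj c -> bdef a b ->
    mul a (badd b c) = badd (mul a b) (mul a c) ;
  fell_mulZl : forall (l : R[i]) a b, bdef a b ->
    mul (bscale l a) b = bscale l (mul a b) ;
  fell_mulZr : forall (l : R[i]) a b, bdef a b ->
    mul a (bscale l b) = bscale l (mul a b) ;
  fell_starD : forall a b, proj a = proj b ->
    star (badd a b) = badd (star a) (star b) ;
  fell_starZ : forall (l : R[i]) a,
    star (bscale l a) = bscale (Num.conj l) (star a) ;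
  fell_norm_mul : forall a b, bdef a b ->
    bnorm (mul a b) <= bnorm a * bnorm b ;
  fell_norm_star_mul : forall b, bnorm (mul (star b) b) = bnorm b ^+ 2 ;
  fell_positive : forall b, exists a,
    proj a = proj (mul (star b) b) /\ mul (star a) a = mul (star b) b
}.

Record fellBundle (R : realType) (G : etaleGroupoid) := FellBundle {
  fell_bundle :> banachBundle R G ;
  bmul : tot fell_bundle -> tot fell_bundle -> tot fell_bundle ;
  bstar : tot fell_bundle -> tot fell_bundle ;
  fell_axioms : isFellBundle bmul bstar
}.

(** A dependent function [a] represents the section [fun g => inc (a g)] of
    [proj]; every section is of this form for a unique [a]. *)
Definition sections (R : realType) (X : topologicalType)
    (rho : bundleData R X) : Type :=
  forall x : X, fib rho x.

Section SectionsLmodule.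
Context (R : realType) (X : topologicalType) (rho : bundleData R X).
Local Notation S := (sections rho).

HB.instance Definition _ := gen_eqMixin S.
HB.instance Definition _ := gen_choiceMixin S.

Let szero : S := fun=> 0.
Let sadd (a b : S) : S := fun x => a x + b x.
Let sopp (a : S) : S := fun x => - a x.
Let sscale (l : R[i]) (a : S) : S := fun x => l *: a x.

Let saddA : associative sadd.
Proof. by move=> a b c; apply: functional_extensionality_dep => x; exact: addrA. Qed.

Let saddC : commutative sadd.
Proof. by move=> a b; apply: functional_extensionality_dep => x; exact: addrC. Qed.

Let sadd0 : left_id szero sadd.
Proof. by move=> a; apply: functional_extensionality_dep => x; exact: add0r. Qed.

Let saddN : left_inverse szero sopp sadd.
Proof. by move=> a; apply: functional_extensionality_dep => x; exact: addNr. Qed.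

HB.instance Definition _ := GRing.isZmodule.Build S saddA saddC sadd0 saddN.

Let sscaleA (k l : R[i]) (a : S) : sscale k (sscale l a) = sscale (k * l) a.
Proof. by apply: functional_extensionality_dep => x; exact: scalerA. Qed.

Let sscale1 : left_id 1 sscale.
Proof. by move=> a; apply: functional_extensionality_dep => x; exact: scale1r. Qed.

Let sscaleDr : right_distributive sscale +%R.
Proof. by move=> k a b; apply: functional_extensionality_dep => x; exact: scalerDr. Qed.

Let sscaleDl (a : S) : {morph sscale^~ a : k l / k + l}.
Proof. by move=> k l; apply: functional_extensionality_dep => x; exact: scalerDl. Qed.

HB.instance Definition _ :=
  GRing.Zmodule_isLmodule.Build R[i] S sscaleA sscale1 sscaleDr sscaleDl.

End SectionsLmodule.

Definition supp (R : realType) (X : topologicalType) (rho : bundleData R X)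
    (a : sections rho) : set X :=
  [set x | a x <> 0].

Definition finitely_supported (R : realType) (X : topologicalType)
    (rho : bundleData R X) : set (sections rho) :=
  [set f | finite_set (supp f)].
Arguments finitely_supported {R X} rho _.

Section SectionNorms.
Context (R : realType) (G : etaleGroupoid) (rho : fellBundle R G).
Local Open Scope ereal_scope.

Definition convolution (a f : sections rho) : sections rho := fun g =>
  (\sum_(p \in [set p : G * G | composable p.1 p.2 /\ gmul p.1 p.2 = g])
    coord g (bmul (inc (a p.1)) (inc (f p.2))))%R.

Definition norm2_partial (a : sections rho) (x : G) (F : set G) : R :=
  Num.sqrt (fnorm
    (\sum_(g \in F) coord x (bmul (bstar (inc (a g))) (inc (a g))))%R).

(** [0] is adjoined because suprema are taken in [[0, +oo]], while
    [ereal_sup set0 = -oo]: this only matters when [G] is empty. *)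
Definition norm2 (a : sections rho) : \bar R :=
  ereal_sup ([set 0] `|`
    [set ereal_sup
       [set (norm2_partial a x F)%:E | F in fsets [set g : G | src g = x]]
    | x in units G]).

(** In [\bar R], [0 / 0 = 0 * +oo = 0]. *)
Definition normb (a : sections rho) : \bar R :=
  ereal_sup [set norm2 (convolution a f) / norm2 f
            | f in finitely_supported rho].

End SectionNorms.

(** [(S, N)] is a complex Banach space, for a subset [S] of a complex vector
    space [E] and an extended norm [N] that is finite on [S]: [S] is a linear
    subspace of [E] and, with the operations of [E] and the norm [N], it is
    (the carrier of) a complete normed module. *)
Definition is_banach_subspace (R : realType) (E : lmodType R[i]) (S : set E)
    (N : E -> \bar R) : Prop :=
  exists (V : completeNormedModType R[i]) (i : {linear V -> E}),
    [/\ injective i, range i = S &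
        forall v : V, N (i v) = (complex.Re `|v|)%:E].

(* Main.v *)
From HB Require Import structures.
From mathcomp Require Import all_boot all_order all_algebra.
From mathcomp Require Import finmap complex.
From mathcomp Require Import all_classical all_reals all_analysis.
From mathcomp Require Import ring lra.
Require Import Defs.

(** The heart of the matter is the triangle inequality for [norm2], that is, the
    Minkowski inequality for the fibrewise inner product
    [<a, b> = sum_(g in F) a(g)^* b(g)] with values in the C*-algebra [B_x]. From
    the identity
      [r t <a + b, a + b> + <t a - r b, t a - r b> = (r + t) (t <a, a> + r <b, b>)]
    with [r], [t] slightly larger than the norms of [a] and [b], it reduces to
    [|p| <= |p + q|] for [p], [q] sums of elements [c^* c] of [B_x].
    This monotonicity is obtained in the unitization without spectral theory:
    call a self-adjoint [h] positive when [|t - h| <= t] for some [t >= 0], a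
    condition obviously stable under sums. Approximating [sqrt (1 - h)] by
    polynomials in [h], and bounding [x] by the normal element [x + i y] for
    commuting self-adjoint [x], [y], gives the monotonicity for positive elements;
    elements [c^* c] are positive by a variant of Kaplansky's argument.

    Testing [normb a] against [f] supported at the source of [g] with value
    [a(g)^* a(g)] gives [|a(g)| <= normb a]. Hence a Cauchy filter converges
    pointwise, and since [(a f)(g)] involves finitely many values of [a], the
    pointwise limit is a limit in [normb]. *)

Set Implicit Arguments.
Unset Strict Implicit.
Unset Printing Implicit Defensive.

Import Order.TTheory GRing.Theory Num.Theory.
Import numFieldNormedType.Exports.

Local Open Scope classical_set_scope.
Local Open Scope ring_scope.
Local Open Scope complex_scope.

(** * C*-seminorms on unital *-algebras *)

(** Modelled on the unitization below: its operator norm vanishes on [(-e, 1)] when the algebra has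
    a unit [e], and over the zero algebra even [N 1 = 0]. *)
Record isCstarSeminorm (R : realType) (E : algType R[i]) (star : E -> E)
    (N : E -> R) : Prop := {
  cstarK : involutive star ;
  cstarD : {morph star : x y / x + y} ;
  cstarM : forall x y, star (x * y) = star y * star x ;
  cstarZ : forall (l : R[i]) x, star (l *: x) = Num.conj l *: star x ;
  cnormD : forall x y, N (x + y) <= N x + N y ;
  cnormZ : forall (l : R[i]) x, N (l *: x) = complex.Re `|l| * N x ;
  cnormM : forall x y, N (x * y) <= N x * N y ;
  cnorm_star_mul : forall x, N (star x * x) = N x ^+ 2 ;
  cnorm1_le : N 1 <= 1
}.

Lemma Re_normc_real (R : realType) (t : R) : complex.Re `|t%:C| = `|t|.
Proof. by rewrite normc_def /= expr0n /= addr0 sqrtr_sqr. Qed.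

Lemma conj_realC (R : realType) (t : R) : Num.conj t%:C = t%:C.
Proof. by apply/CrealP; apply/complex_realP; exists t. Qed.

Lemma bernoulli_le (R : realDomainType) (d : R) n :
  0 <= d -> 1 + n%:R * d <= (1 + d) ^+ n.
Proof.
move=> d0; elim: n => [|n IH]; first by rewrite mul0r addr0 expr0.
rewrite exprS -natr1; have n0 : 0 <= n%:R :> R by [].
have := ler_wpM2l (_ : 0 <= 1 + d) IH.
move=> /(_ (addr_ge0 ler01 d0)); apply: le_trans.
have : 0 <= n%:R * d * d by rewrite !mulr_ge0.
nra.
Qed.

(** If [x = 1 + d] with [d > 0], Bernoulli and squaring make [x] to the power [2 k] at least
    [(1 + k d)^2], quadratic in [k], against a linear bound. Exponents are powers of two because
    [cnormX2_sa] evaluates only those. *)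
Lemma le1_linear_growth (R : realType) (x C : R) : 0 <= x ->
  (forall n, x ^+ (2 ^ n) <= 1 + (2 ^ n)%:R * C) -> x <= 1.
Proof.
move=> x0 H; rewrite leNgt; apply/negP => x1.
have [d d0 xE] : exists2 d : R, 0 < d & x = 1 + d.
  by exists (x - 1); [rewrite subr_gt0|rewrite addrC subrK].
have C0 : 0 <= `|C| by [].
(* Chosen so that [m.+1 * d ^+ 2] exceeds [2 * |C| + 1]; since [k >= m.+1], the quadratic term in
   [k] then wins. *)
set m := Num.truncn ((2 * `|C| + 1) / d ^+ 2 + 1).
have mb : (2 * `|C| + 1) / d ^+ 2 < m.+1%:R.
  have := Num.Theory.truncnS_gt ((2 * `|C| + 1) / d ^+ 2 + 1).
  by apply: le_lt_trans; rewrite lerDl.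
have m0 : 0 <= m.+1%:R :> R by [].
have H1 : 2 * `|C| + 1 < m.+1%:R * d ^+ 2.
  by rewrite -ltr_pdivrMr // exprn_gt0.
pose k : R := (2 ^ m.+1)%:R.
have km : m.+1%:R <= k by rewrite ler_nat ltnW // ltn_expl.
have k1 : 1 <= k by rewrite (le_trans _ km) // ler1n.
have H2 := H m.+2.
rewrite expnS [(2 * _)%N]mulnC exprM in H2.
have H3 : (1 + k * d) ^+ 2 <= 1 + k * 2 * C.
  apply: le_trans (_ : (x ^+ (2 ^ m.+1)) ^+ 2 <= _); last first.
    by rewrite /k -natrM.
  have kd0 : 0 <= k * d by rewrite mulr_ge0 // ltW // (lt_le_trans ltr01).
  rewrite ler_sqr ?nnegrE ?addr_ge0 ?exprn_ge0 //.
  by rewrite xE; apply: bernoulli_le; exact: ltW.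
have H4 : 1 + k * 2 * C <= 1 + k * (2 * `|C|).
  by have := ler_norm C; nra.
have H5 : k * (2 * `|C| + 1) < k * (m.+1%:R * d ^+ 2).
  by rewrite ltr_pM2l // (lt_le_trans ltr01).
have H6 : k * (m.+1%:R * d ^+ 2) <= k * (k * d ^+ 2).
  by rewrite ler_pM2l ?(lt_le_trans ltr01) // ler_wpM2r // sqr_ge0.
nra.
Qed.

Section CstarSeminorm.
Context (R : realType) (E : algType R[i]) (star : E -> E) (N : E -> R).
Context (HN : isCstarSeminorm star N).
Implicit Types (x y h k s p q : E) (t r : R).

Let starK := cstarK HN.
Let starD := cstarD HN.
Let starM := cstarM HN.
Let starZ := cstarZ HN.
Let ND := cnormD HN.
Let NZ := cnormZ HN.
Let NM := cnormM HN.
Let NC := cnorm_star_mul HN.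
Let N1 := cnorm1_le HN.

Let star0 : star 0 = 0.
Proof. by rewrite -[X in star X](scale0r (0 : E)) starZ conjC0 scale0r. Qed.

Let starN x : star (- x) = - star x.
Proof. by apply/eqP; rewrite -addr_eq0 -starD addNr star0. Qed.

Let starB x y : star (x - y) = star x - star y.
Proof. by rewrite starD starN. Qed.

Let star1 : star 1 = 1.
Proof. by rewrite -[LHS]mulr1 -[in X in _ * X](starK 1) -starM mulr1 starK. Qed.

Let starZr t x : star (t%:C *: x) = t%:C *: star x.
Proof. by rewrite starZ conj_realC. Qed.

Let NZr t x : N (t%:C *: x) = `|t| * N x.
Proof. by rewrite NZ Re_normc_real. Qed.

Let NN x : N (- x) = N x.
Proof.
have -> : - x = (-1 : R)%:C *: x by rewrite rmorphN rmorph1 scaleN1r.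
by rewrite NZr normrN1 mul1r.
Qed.

Let N0 : N 0 = 0.
Proof. by rewrite -[X in N X](scale0r (0 : E)) NZ normr0 mul0r. Qed.

Lemma cnorm_ge0 x : 0 <= N x.
Proof. by have := ND x (- x); rewrite subrr N0 NN; lra. Qed.

Let NDB x y : N (x - y) = N (y - x).
Proof. by rewrite -NN opprB. Qed.

Lemma cnorm_le_shift x y : N x <= N y + N (x - y).
Proof. by have := ND y (x - y); rewrite addrC subrK. Qed.

Lemma cnorm_star x : N (star x) = N x.
Proof.
suff H y : N y <= N (star y) by apply/eqP; rewrite eq_le H -{2}(starK x) H.
have [->|y0] := eqVneq (N y) 0; first exact: cnorm_ge0.
have Ny : 0 < N y by rewrite lt_def y0 cnorm_ge0.
by rewrite -(ler_pM2r Ny) -expr2 -NC NM.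
Qed.

Let NX_sa h : star h = h -> N (h * h) = N h ^+ 2.
Proof. by move=> sh; rewrite -NC sh. Qed.

(** The C*-identity squares the norm of a self-adjoint element along with the element; iterating it
    reaches exactly the powers of two. *)
Lemma cnormX2_sa h n : star h = h -> N (h ^+ (2 ^ n)) = N h ^+ (2 ^ n).
Proof.
elim: n h => [|n IH] h sh; first by rewrite !expr1.
by rewrite expnS !exprM IH ?expr2 ?NX_sa // starM sh.
Qed.

Let starX_sa h n : star h = h -> star (h ^+ n) = h ^+ n.
Proof.
move=> sh; elim: n => [|n IH]; first by rewrite expr0.
by rewrite exprS starM IH sh -exprSr -exprS.
Qed.

Let comm_scale (l : R[i]) x y : GRing.comm x y -> GRing.comm x (l *: y).
Proof. by rewrite /GRing.comm => xy; rewrite -scalerAl -scalerAr xy. Qed.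

Let comm_scal (l : R[i]) x : GRing.comm x l%:A.
Proof. exact/comm_scale/commr1. Qed.

(* [x + i y] is normal, and its adjoint [x - i y] has the same norm. *)
Lemma cnorm_le_sum_squares x y : star x = x -> star y = y -> GRing.comm x y ->
  N x ^+ 2 <= N (x * x + y * y).
Proof.
move=> sx sy xy; pose u : E := x + ('i : R[i]) *: y.
have su : star u = x - ('i : R[i]) *: y.
  rewrite starD starZ sx sy.
  have -> : Num.conj ('i : R[i]) = - 'i by apply/eqP; rewrite eq_complex /= oppr0 !eqxx.
  by rewrite scaleNr.
have uu : star u * u = x * x + y * y.
  rewrite su /u mulrDr !mulrBl -!scalerAl -!scalerAr scalerA xy.
  rewrite (_ : 'i * 'i = -1 :> R[i]); last by rewrite -expr2 sqr_i.
  rewrite scaleN1r opprK addrA; congr (_ + _).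
  by rewrite subrK.
rewrite -uu NC ler_sqr ?nnegrE ?cnorm_ge0 //.
have -> : x = (2^-1 : R)%:C *: (u + star u).
  rewrite su /u addrACA subrr addr0 -[X in X + X]scale1r -scalerDl scalerA.
  by rewrite -(rmorph1 (real_complex R)) -rmorphD -rmorphM mulVf ?scale1r.
rewrite NZr ger0_norm ?invr_ge0 //.
have := ND u (star u); rewrite cnorm_star; lra.
Qed.

(** * Approximate square roots by iteration *)

Let h2 : R[i] := (2^-1 : R)%:C.

Let h2D x : h2 *: x + h2 *: x = x.
Proof.
rewrite -scalerDl -rmorphD (_ : 2^-1 + 2^-1 = 1 :> R) ?scale1r //.
by field.
Qed.

(* Iterates converging to [1 - sqrt (1 - h)]. *)
Let yseq h n : E := iter n (fun y => h2 *: (h + y * y)) 0.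
Let eseq n : R := iter n (fun y : R => 2^-1 * (1 + y * y)) 0.

Let yseqS h n : yseq h n.+1 = h2 *: (h + yseq h n * yseq h n).
Proof. by []. Qed.

Let eseqS n : eseq n.+1 = 2^-1 * (1 + eseq n * eseq n).
Proof. by []. Qed.

Let eseq_bound n : 0 <= eseq n <= 1.
Proof.
elim: n => [|n /andP[IH1 IH2]]; first by rewrite /eseq /= lexx ler01.
by rewrite eseqS; apply/andP; split; nra.
Qed.

Let yseq_sa h n : star h = h -> star (yseq h n) = yseq h n.
Proof.
move=> sh; elim: n => [|n IH]; first exact: star0.
by rewrite yseqS starZr starD starM IH sh.
Qed.

Let yseq_comm h z n : GRing.comm z h -> GRing.comm z (yseq h n).
Proof.
move=> zh; elim: n => [|n IH]; first exact: commr0.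
by rewrite yseqS; apply: comm_scale; apply: commrD => //; apply: commrM.
Qed.

Let yseq_norm h n : N h <= 1 -> N (yseq h n) <= eseq n.
Proof.
move=> Nh; elim: n => [|n IH]; first by rewrite N0.
rewrite yseqS eseqS NZr ger0_norm ?invr_ge0 //.
have := ND h (yseq h n * yseq h n); have := NM (yseq h n) (yseq h n).
have := cnorm_ge0 (yseq h n); nra.
Qed.

(** [eseq] is the scalar iteration at [h = 1] and serves as majorant: the iterates commute, so the
    difference of two squares factors, and each increment is half the previous one times a sum of
    two iterates. *)
Let yseq_incr h n : N h <= 1 ->
  N (yseq h n.+1 - yseq h n) <= eseq n.+1 - eseq n.
Proof.
move=> Nh; elim: n => [|n IH].
  rewrite yseqS eseqS /yseq /eseq /= !mulr0 !addr0 !subr0 NZr.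
  by rewrite ger0_norm ?invr_ge0 //; lra.
set y := yseq h n.+1 in IH *; set y' := yseq h n in IH *.
have cy : GRing.comm y y'.
  by apply: yseq_comm; apply/commr_sym/yseq_comm/commr_refl.
have -> : yseq h n.+2 - y = h2 *: ((y - y') * (y + y')).
  rewrite yseqS -/y {2}/y yseqS -/y' -scalerBr; congr (_ *: _).
  rewrite opprD addrACA subrr add0r mulrBl !mulrDr cy opprD addrA addrK.
  by [].
rewrite NZr ger0_norm ?invr_ge0 //.
have := NM (y - y') (y + y'); have := ND y y'.
have := @yseq_norm h n.+1 Nh; have := @yseq_norm h n Nh; rewrite -/y -/y'.
have := cnorm_ge0 (y - y'); have := cnorm_ge0 (y + y').
have := eseq_bound n.+1; have := eseq_bound n => /andP[a0 a1] /andP[b0 b1].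
rewrite [eseq n.+2]eseqS.
have -> : eseq n.+1 = 2^-1 * (1 + eseq n * eseq n) by [].
rewrite -eseqS => c d e f g i.
have E1 : N (y - y') * N (y + y') <= (eseq n.+1 - eseq n) * (eseq n.+1 + eseq n).
  by apply: ler_pM => //; lra.
have E2 := eseqS n; nra.
Qed.

(** The sequence stays in [[0, 1]], so its increments cannot all exceed [e]. *)
Let eseq_cvg (e : R) : 0 < e -> exists n, eseq n.+1 - eseq n <= e.
Proof.
move=> e0; apply: contrapT => /forallNP H.
have H1 n : n%:R * e <= eseq n.
  elim: n => [|n IH]; first by rewrite mul0r.
  have /negP := H n; rewrite -ltNge -natr1; lra.
have := Num.Theory.truncnS_gt (e^-1); set m := (Num.truncn _).+1 => H2.
have /andP[_] := eseq_bound m; apply/negP; rewrite -ltNge.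
by apply: lt_le_trans (H1 m); rewrite -ltr_pdivrMr // mul1r.
Qed.

(** For [s = 1 - yseq h n] the error is [2 (yseq h n - yseq h n.+1)]. The commutation clause later
    makes the roots of two commuting elements commute. *)
Lemma approx_sqrt h (e : R) : star h = h -> N h <= 1 -> 0 < e ->
  exists s, [/\ star s = s, forall z, GRing.comm z h -> GRing.comm z s &
    N (1 - h - s * s) <= e].
Proof.
move=> sh Nh e0; have /eseq_cvg[n Hn] : 0 < e / 2 by rewrite divr_gt0.
exists (1 - yseq h n); split.
- by rewrite starB star1 yseq_sa.
- by move=> z zh; apply: commrB; [exact: commr1|exact: yseq_comm].
have -> : 1 - h - (1 - yseq h n) * (1 - yseq h n) =
    (2 : R)%:C *: (yseq h n - yseq h n.+1).
  rewrite yseqS scalerBr scalerA -rmorphM divff // scale1r.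
  rewrite mulrBr mulr1 !mulrBl mul1r.
  have -> : (2 : R)%:C *: yseq h n = yseq h n + yseq h n.
    by rewrite (rmorph_nat (real_complex R)) scaler_nat mulr2n.
  rewrite !opprD !opprK !addrA.
  by rewrite (addrC 1 (-h)) addrK; rewrite -!addrA [LHS]addrC -!addrA;
     congr (_ + (_ + _)); rewrite addrC.
rewrite NZr NDB normr_nat; have := @yseq_incr h n Nh; lra.
Qed.

(** * Positive elements and monotonicity of the norm *)

Definition cpos h : Prop :=
  star h = h /\ exists2 t : R, 0 <= t & N (t%:C%:A - h) <= t.

Let NA_le t : N t%:C%:A <= `|t|.
Proof. by rewrite NZr ler_piMr. Qed.

Let starA t : star t%:C%:A = t%:C%:A.
Proof. by rewrite starZr star1. Qed.

(** Adding [t - t0] times the unit costs at most [t - t0] in norm. This supplies a strictly positive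
    [t] to divide by. *)
Lemma cpos_weaken h : cpos h ->
  exists2 t0 : R, 0 <= t0 & forall t, t0 <= t -> N (t%:C%:A - h) <= t.
Proof.
case=> sh [t0 t00 Nt0]; exists t0 => // t t0t.
have -> : t%:C%:A - h = (t0%:C%:A - h) + (t - t0)%:C%:A.
  by rewrite rmorphB /= scalerBl [RHS]addrC addrA subrK.
have := ND (t0%:C%:A - h) (t - t0)%:C%:A.
have := NA_le (t - t0); rewrite ger0_norm ?subr_ge0 //; lra.
Qed.

Lemma cposD p q : cpos p -> cpos q -> cpos (p + q).
Proof.
move=> [sp [t t0 Nt]] [sq [r r0 Nr]]; split; first by rewrite starD sp sq.
exists (t + r); first exact: addr_ge0.
rewrite rmorphD /= scalerDl opprD addrACA.
by apply: le_trans (ND _ _) _; apply: lerD.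
Qed.

Lemma cposZ r p : 0 <= r -> cpos p -> cpos (r%:C *: p).
Proof.
move=> r0 [sp [t t0 Nt]]; split; first by rewrite starZr sp.
exists (r * t); first exact: mulr_ge0.
by rewrite rmorphM /= -scalerA -scalerBr NZr ger0_norm // ler_wpM2l.
Qed.

Lemma cpos_sub h r : star h = h -> N h <= r -> cpos (r%:C%:A - h).
Proof.
move=> sh Nh; split; first by rewrite starB starA sh.
by exists r; [exact: le_trans (cnorm_ge0 _) Nh|rewrite subKr].
Qed.

(** Write [h = t (1 - h')], where [h' = 1 - h / t] has norm at most 1, and rescale an approximate
    root of [1 - h'] by the square root of [t]. *)
Lemma cpos_approx_square h (e : R) : cpos h -> 0 < e ->
  exists s, [/\ star s = s, forall z, GRing.comm z h -> GRing.comm z s &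
    N (h - s * s) <= e].
Proof.
move=> ph e0; have [sh _] := ph; have [t0 t00 Ht] := cpos_weaken ph.
pose t := t0 + 1; have t1 : 0 < t by rewrite /t; lra.
pose h' : E := 1 - t^-1%:C *: h.
have sh' : star h' = h' by rewrite starB star1 starZr sh.
have hE : t%:C *: h' = t%:C%:A - h.
  by rewrite scalerBr scalerA -rmorphM divff ?gt_eqF // scale1r.
have Nh' : N h' <= 1.
  have : N (t%:C *: h') <= t by rewrite hE; apply: Ht; rewrite lerDl.
  by rewrite NZr gtr0_norm // ger_pMr.
have [s [ss sc Ns]] := approx_sqrt sh' Nh' (divr_gt0 e0 t1).
exists ((Num.sqrt t)%:C *: s); split.
- by rewrite starZr ss.
- move=> z zh; apply/comm_scale/sc/commrB; [exact: commr1|exact: comm_scale].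
have -> : h - ((Num.sqrt t)%:C *: s) * ((Num.sqrt t)%:C *: s) =
    t%:C *: (1 - h' - s * s).
  rewrite -scalerAl -scalerAr scalerA -rmorphM -expr2 sqr_sqrtr ?ltW //.
  by rewrite /h' subKr scalerBr scalerA -rmorphM divff ?gt_eqF // scale1r.
by rewrite NZr gtr0_norm // -ler_pdivlMl // mulrC.
Qed.

Let ler_eps (a b c : R) : (forall e, 0 < e -> a <= b + c * e) -> a <= b.
Proof.
move=> H; apply/ler_addgt0Pr => e e0.
have c1 : 0 < `|c| + 1 by rewrite ltr_pwDr.
apply: le_trans (H _ (divr_gt0 e0 c1)) _; rewrite lerD2l mulrA ler_pdivrMr //.
rewrite mulrC ler_pM2l //; have := ler_norm c; lra.
Qed.

(* Approximate [p] and [c - p] by commuting squares [k^2] and [s^2]; then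
   [k + i s] has norm about [sqrt c]. *)
Lemma cnorm_le_of_cpos p r : 0 <= r -> cpos p -> cpos (r%:C%:A - p) -> N p <= r.
Proof.
(* Three errors of size [e]: two in replacing [r] by [k k + s s], one in replacing [p] by [k k]. *)
move=> r0 pp pr; apply: (@ler_eps _ _ 3) => e e0.
have [k [sk ck Nk]] := cpos_approx_square pp e0.
have [s [ss cs Ns]] := cpos_approx_square pr e0.
have ks : GRing.comm k s.
  apply/cs/commr_sym/ck/commr_sym; apply: commrB; last exact: commr_refl.
  exact: comm_scal.
have H1 := cnorm_le_sum_squares sk ss ks.
have H2 : N (k * k + s * s) <= r + 2 * e.
  have -> : k * k + s * s = r%:C%:A - (p - k * k) - (r%:C%:A - p - s * s).
    set z := r%:C%:A - p; rewrite opprB [r%:C%:A + _]addrA [_ + k * k - p]addrAC -/z.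
    by rewrite opprB addrA addrAC [z + _]addrC addrK.
  have := ND (r%:C%:A - (p - k * k)) (- (r%:C%:A - p - s * s)).
  have := ND (r%:C%:A) (- (p - k * k)); have := NA_le r.
  by rewrite !NN (ger0_norm r0); lra.
have := cnorm_le_shift p (k * k); rewrite NX_sa //; lra.
Qed.

(** [r - k^2] is positive by [cpos_sub]. If [s^2] approximates it, then [s^2 + k^2] is close to [r],
    so [cnorm_le_sum_squares] bounds [N s ^+ 2], hence [N (r - k^2)], by about [r]. *)
Lemma cpos_square k : star k = k -> cpos (k * k).
Proof.
move=> sk; set r := N k ^+ 2; have r0 : 0 <= r by exact: sqr_ge0.
have skk : star (k * k) = k * k by rewrite starM sk.
have pr : cpos (r%:C%:A - k * k) by apply: cpos_sub => //; rewrite NX_sa.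
split => //; exists r => //; apply: (@ler_eps _ _ 2) => e e0.
have [s [ss cs Ns]] := cpos_approx_square pr e0.
have ks : GRing.comm s k.
  apply/commr_sym/cs; apply: commrB; first exact: comm_scal.
  by apply: commrM.
have H1 := cnorm_le_sum_squares ss sk ks.
have H2 : N (s * s + k * k) <= r + e.
  have -> : s * s + k * k = r%:C%:A - (r%:C%:A - k * k - s * s).
    by rewrite -addrA -opprD subKr addrC.
  have := ND (r%:C%:A) (- (r%:C%:A - k * k - s * s)); have := NA_le r.
  by rewrite !NN (ger0_norm r0); lra.
have := cnorm_le_shift (r%:C%:A - k * k) (s * s); rewrite (NX_sa ss); lra.
Qed.

(** With [M = N (p + q)], the element [M - p] is the sum of the positive elements [M - (p + q)] and
    [q]. *)
Lemma cnorm_le_cposD p q : cpos p -> cpos q -> N p <= N (p + q).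
Proof.
move=> pp pq; apply: cnorm_le_of_cpos; [exact: cnorm_ge0|by []|].
have -> : (N (p + q))%:C%:A - p = (N (p + q))%:C%:A - (p + q) + q.
  by rewrite opprD addrA subrK.
by apply: cposD => //; apply: cpos_sub => //; have [] := cposD pp pq.
Qed.

(** Replaces the unspecified witness of [cpos] by one controlled by the norm, which lets positivity
    pass to limits; it is [cnorm_le_of_cpos] applied to [t - h]. *)
Lemma cpos_le h t : cpos h -> N h <= t -> N (t%:C%:A - h) <= t.
Proof.
move=> ph Nt; have [sh _] := ph.
apply: cnorm_le_of_cpos; [exact: le_trans (cnorm_ge0 _) Nt|exact: cpos_sub|].
by rewrite subKr.
Qed.

(** By [cpos_le] the approximant [k] has witness [N h + e], so its inequality carries over to [h]
    with loss [3 e]. *)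
Lemma cpos_closed h : star h = h ->
  (forall e : R, 0 < e -> exists2 k, cpos k & N (h - k) <= e) -> cpos h.
Proof.
move=> sh H; split=> //; exists (N h); first exact: cnorm_ge0.
apply: (@ler_eps _ _ 3) => e e0; have [k pk Nk] := H e e0.
have Nk' : N k <= N h + e by have := cnorm_le_shift k h; rewrite NDB; lra.
have := cpos_le pk Nk'.
have -> : (N h)%:C%:A - h = ((N h + e)%:C%:A - k) - (e%:C%:A + (h - k)).
  rewrite rmorphD /= scalerDl; set a := _%:A; set b := _%:A.
  by rewrite [a + b]addrC -[b + a - k]addrA opprD addrACA subrr add0r opprB addrA subrK.
have := ND ((N h + e)%:C%:A - k) (- (e%:C%:A + (h - k))).
have := ND e%:C%:A (h - k); have := NA_le e; rewrite NN (gtr0_norm e0); lra.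
Qed.

(** Approximating [p] and [q] by squares of commuting self-adjoint [k] and [s] brings [p * q] close
    to the square of [k * s]; positivity is closed. *)
Lemma cposM p q : cpos p -> cpos q -> GRing.comm p q -> cpos (p * q).
Proof.
move=> pp pq pq_comm; have [sp _] := pp; have [sq _] := pq.
apply: cpos_closed => [|e e0]; first by rewrite starM sp sq pq_comm.
(* The error will be at most [d * N q + (N p + d) * d], which is at most [c * d] because
   [d <= 1]. *)
pose c := N q + N p + 1.
have c0 : 0 < c by rewrite /c; have := cnorm_ge0 p; have := cnorm_ge0 q; lra.
pose d := Num.min 1 (e / c).
have d0 : 0 < d by rewrite lt_min ltr01 divr_gt0.
have d1 : d <= 1 by rewrite ge_min lexx.
have de : c * d <= e by rewrite mulrC -ler_pdivlMr // ge_min lexx orbT.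
have [k [sk ck Nk]] := cpos_approx_square pp d0.
have [s [ss cs Ns]] := cpos_approx_square pq d0.
have ks : GRing.comm k s by apply/cs/commr_sym/ck/commr_sym.
exists ((k * s) * (k * s)).
  by apply: cpos_square; rewrite starM sk ss ks.
have -> : p * q - (k * s) * (k * s) = (p - k * k) * q + k * k * (q - s * s).
  rewrite mulrBl mulrBr addrA subrK; congr (_ - _).
  by rewrite !mulrA -(mulrA k s k) -ks !mulrA.
have := ND ((p - k * k) * q) (k * k * (q - s * s)).
have := NM (p - k * k) q; have := NM (k * k) (q - s * s).
have Nkk : N (k * k) <= N p + d by have := cnorm_le_shift (k * k) p; rewrite NDB; lra.
have : N (p - k * k) * N q <= d * N q by rewrite ler_wpM2r // cnorm_ge0.
have : N (k * k) * N (q - s * s) <= (N p + d) * d.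
  by apply: ler_pM => //; apply: cnorm_ge0.
move: de; rewrite /c; have : d * d <= d by rewrite ger_pMl.
nra.
Qed.

(** * Positivity of [star a * a] *)

Let cpos1 : cpos 1.
Proof. by rewrite -[1]mulr1; exact: cpos_square. Qed.

Lemma cposX p n : cpos p -> cpos (p ^+ n).
Proof.
move=> pp; elim: n => [|n IH]; first by rewrite expr0.
by rewrite exprS; apply: cposM => //; apply: commrX; apply: commr_refl.
Qed.

(** Passing from [n] to [n.+1] adds [h^2 (1 - h)^n], a product of commuting positive elements. At
    this stage [1 - h] and [h^2], but not [h], are known to be positive. *)
Let cpos_1subM h n : star h = h -> N h <= 1 -> cpos (1 - h * (1 - h) ^+ n).
Proof.
move=> sh Nh; have pm : cpos (1 - h) by have := cpos_sub sh Nh; rewrite scale1r.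
elim: n => [|n IH]; first by rewrite expr0 mulr1.
have -> : 1 - h * (1 - h) ^+ n.+1 = (1 - h * (1 - h) ^+ n) + h * h * (1 - h) ^+ n.
  by rewrite exprS mulrA mulrBr mulr1 mulrBl opprB addrA addrAC.
apply: cposD => //; apply: cposM; [exact: cpos_square|exact: cposX|].
by apply: commrX; apply: commrB; [exact: commr1|apply/commr_sym/commrM; exact: commr_refl].
Qed.

(** With [b = x + i y], where [x] and [y] are self-adjoint, the sum equals [2 (x^2 + y^2)]. *)
Let cpos_sym b : cpos (star b * b + b * star b).
Proof.
pose x := h2 *: (b + star b); pose y := (h2 * 'i) *: (star b - b).
have sx : star x = x by rewrite /x starZr starD starK addrC.
have sy : star y = y.
  rewrite /y starZ starB starK.
  have -> : Num.conj (h2 * 'i) = - (h2 * 'i).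
    by apply/eqP; rewrite eq_complex /=; apply/andP; split; apply/eqP; ring.
  by rewrite scaleNr -scalerN opprB.
suff -> : star b * b + b * star b = (2 : R)%:C *: (x * x + y * y).
  by apply: cposZ => //; apply: cposD; apply: cpos_square.
rewrite /x /y -!scalerAl -!scalerAr !scalerA.
have -> : h2 * 'i * (h2 * 'i) = - (h2 * h2) :> R[i].
  by rewrite mulrACA -[X in _ * X]expr2 sqr_i mulrN1.
rewrite scaleNr -scalerBr scalerA.
have -> : (2 : R)%:C * (h2 * h2) = h2 by rewrite -!rmorphM; congr (_%:C); field.
have -> : (b + star b) * (b + star b) - (star b - b) * (star b - b) =
    (star b * b + b * star b) + (star b * b + b * star b).
  rewrite mulrDr mulrBr !mulrBl !mulrDl.
  set u := b * b; set v := star b * b; set w := b * star b; set z := star b * star b.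
  rewrite !opprB.
  have -> : u + v + (w + z) + (v - u + (w - z)) = (u + v + (v - u)) + (w + z + (w - z)).
    by rewrite addrACA.
  have H (c d : E) : d + c + (c - d) = c + c by rewrite addrAC addrCA subrr addr0.
  by rewrite H [w + z]addrC H addrACA.
by rewrite scalerDr h2D.
Qed.

(** Put [H = b^* b] and [G = b b^*] for [b = a (1 - h)^n]; the even exponent gives [H] this form.
    Then [1 + H = (1 - G) + (H + G)] and [2 - (1 + H) = 1 - H] are positive, so [N (1 + H) <= 2]. *)
Let growth (a : E) n : N a <= 1 ->
  N (star a * a * (1 - star a * a) ^+ (n + n)) <= 3.
Proof.
move=> Na; set h := star a * a; pose g := a * star a.
have sh : star h = h by rewrite /h starM starK.
have sg : star g = g by rewrite /g starM starK.
have Nh : N h <= 1 by rewrite /h NC expr_le1 ?cnorm_ge0.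
have Ng : N g <= 1.
  by have := NC (star a); rewrite starK cnorm_star => ->; rewrite expr_le1 ?cnorm_ge0.
have hm (k : nat) : h * (1 - h) ^+ k = (1 - h) ^+ k * h.
  by apply: commrX; apply: commrB; [exact: commr1|exact: commr_refl].
have agh (k : nat) : a * (1 - h) ^+ k = (1 - g) ^+ k * a.
  elim: k => [|k IH]; first by rewrite !expr0 mulr1 mul1r.
  rewrite exprSr mulrA IH exprSr -!mulrA; congr (_ * _).
  by rewrite mulrBr mulrBl mulr1 mul1r /g /h mulrA.
pose b := a * (1 - h) ^+ n.
have sb : star b = (1 - h) ^+ n * star a.
  by rewrite /b starM starX_sa // starB star1 sh.
have bb : star b * b = h * (1 - h) ^+ (n + n).
  by rewrite sb /b exprD mulrA -[_ * a]mulrA -/h -hm mulrA.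
have bb' : b * star b = g * (1 - g) ^+ (n + n).
  rewrite sb /b mulrA -[a * _ * _]mulrA -exprD agh -mulrA -/g.
  by apply/esym/commrX/commrB; [exact: commr1|exact: commr_refl].
have := cpos_sym b; rewrite bb bb' => psum.
have pH := cpos_1subM (n + n) sh Nh; have pG := cpos_1subM (n + n) sg Ng.
set H := h * _ in psum pH *; set G := g * _ in psum pG.
have p1H : cpos (1 + H).
  have -> : 1 + H = (1 - G) + (H + G) by rewrite [H + G]addrC addrA subrK.
  exact: cposD.
have : N (1 + H) <= 2.
  apply: cnorm_le_of_cpos => //.
  by rewrite (rmorph_nat (real_complex R)) scaler_nat mulr2n opprD addrACA subrr add0r.
by have := cnorm_le_shift H (1 + H); rewrite opprD addrCA subrr addr0 NN; have := N1; lra.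
Qed.

(* Kaplansky's theorem. With [h = a^* a] and [b = a (1 - h)^n], [b^* b] is
   [h (1 - h)^(2n)] and [b b^*] is the same function of [a a^*], while
   [b^* b + b b^*] is positive; hence [h (1 - h)^(2n)] is bounded in [n].
   Telescoping, the powers of [1 - h] grow at most linearly in norm, which
   forces [N (1 - h) <= 1] because [1 - h] is self-adjoint. *)
Lemma cpos_star_mul a : cpos (star a * a).
Proof.
have sh x : star (star x * x) = star x * x by rewrite starM starK.
have contr x : N x <= 1 -> cpos (star x * x).
  move=> Nx; split=> //; exists 1 => //; rewrite scale1r.
  set h := star x * x; have [m mE] : exists m, m = 1 - h by exists (1 - h).
  rewrite -mE.
  have Nh : N h <= 1 by rewrite /h NC expr_le1 ?cnorm_ge0.
  have sm : star m = m by rewrite mE starB star1 sh.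
  have Nm : N m <= 2.
    by have := ND 1 (- h); rewrite NN; have := N1; rewrite mE; lra.
  have m2 : m * m = 1 - h * (1 + m).
    by rewrite {1}mE mulrBl mul1r {1}mE mulrDr mulr1 opprD addrA.
  have hm (k : nat) : h * m ^+ k = m ^+ k * h.
    by apply: commrX; rewrite mE; apply: commrB; [exact: commr1|exact: commr_refl].
  (* Since [m^2 = 1 - h (1 + m)], two more powers subtract [h m^(2n) (1 + m)], of norm at most
     [3 * 3]: [growth] bounds the first factor and [N m <= 2] the second. *)
  have Nmn n : N (m ^+ (n + n)) <= 1 + n%:R * 9.
    elim: n => [|n IH]; first by rewrite expr0; have := N1; lra.
    have -> : m ^+ (n.+1 + n.+1) = m ^+ (n + n) - h * m ^+ (n + n) * (1 + m).
      rewrite addSn addnS !exprSr -mulrA m2 mulrBr mulr1 mulrA.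
      by rewrite hm.
    have := ND (m ^+ (n + n)) (- (h * m ^+ (n + n) * (1 + m))); rewrite NN.
    have := NM (h * m ^+ (n + n)) (1 + m); have := growth n Nx.
    have := ND 1 m; have := N1; have := cnorm_ge0 (h * m ^+ (n + n)).
    have := cnorm_ge0 (1 + m).
    rewrite -/h -mE -natr1; nra.
  apply: (le1_linear_growth (C := 9)) => [|n]; first exact: cnorm_ge0.
  (* The exponent [2 ^ 0] is odd and is covered by [N m <= 2]; all others have the form [k + k]. *)
  rewrite -cnormX2_sa //; case: n => [|n]; first by rewrite expn0 expr1; lra.
  rewrite expnS mul2n -addnn; apply: le_trans (Nmn _) _.
  by rewrite lerD2l ler_wpM2r // ler_nat leq_addr.
have [Na0|Na0] := eqVneq (N a) 0.
  by split=> //; exists 0 => //; rewrite scale0r sub0r NN NC Na0 expr0n.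
have Na : 0 < N a by rewrite lt_def Na0 cnorm_ge0.
pose c := (N a)^-1%:C *: a.
have -> : star a * a = (N a ^+ 2)%:C *: (star c * c).
  rewrite /c starZr -scalerAl -scalerAr !scalerA -!rmorphM.
  by rewrite (_ : _ * _ = 1 :> R) ?scale1r //; field; rewrite gt_eqF.
apply: cposZ; first exact: sqr_ge0.
by apply: contr; rewrite /c NZr gtr0_norm ?invr_gt0 // mulVf.
Qed.

End CstarSeminorm.

(** * Unitization of a C*-algebra *)

(* A non-unital pre-C*-algebra; [cnorm] is only a seminorm. *)
Record cstarAlgebra (R : realType) := CstarAlgebra {
  csort :> lmodType R[i] ;
  cmul : csort -> csort -> csort ;
  cstar : csort -> csort ;
  cnorm : csort -> R ;
  cmulA : associative cmul ;
  cmulDl : left_distributive cmul +%R ;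
  cmulDr : right_distributive cmul +%R ;
  cmulZl : forall (l : R[i]) a b, cmul (l *: a) b = l *: cmul a b ;
  cmulZr : forall (l : R[i]) a b, cmul a (l *: b) = l *: cmul a b ;
  cstar_invol : involutive cstar ;
  cstar_add : {morph cstar : a b / a + b} ;
  cstar_mul : forall a b, cstar (cmul a b) = cmul (cstar b) (cstar a) ;
  cstar_scale : forall (l : R[i]) a, cstar (l *: a) = Num.conj l *: cstar a ;
  cnorm_add : forall a b, cnorm (a + b) <= cnorm a + cnorm b ;
  cnorm_scale : forall (l : R[i]) a, cnorm (l *: a) = complex.Re `|l| * cnorm a ;
  cnorm_mul : forall a b, cnorm (cmul a b) <= cnorm a * cnorm b ;
  cnorm_cstar : forall a, cnorm (cmul (cstar a) a) = cnorm a ^+ 2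
}.

Definition unitization (R : realType) (A : cstarAlgebra R) : Type :=
  (A * R[i])%type.

Section UnitizationRing.
Context (R : realType) (A : cstarAlgebra R).
Local Notation U := (unitization A).
Local Notation "a ** b" := (cmul a b) (at level 40, left associativity).

HB.instance Definition _ := GRing.Lmodule.copy U (A * R[i]^o)%type.

Let uone : U := (0, 1).
Let umul (u v : U) : U :=
  (u.1 ** v.1 + u.2 *: v.1 + v.2 *: u.1, u.2 * v.2).

Lemma cmul0l (a : A) : 0 ** a = 0.
Proof. by rewrite -[X in X ** _](scale0r (0 : A)) cmulZl scale0r. Qed.

Lemma cmul0r (a : A) : a ** 0 = 0.
Proof. by rewrite -[X in _ ** X](scale0r (0 : A)) cmulZr scale0r. Qed.

Let upair_eq (u v : U) : u.1 = v.1 -> u.2 = v.2 -> u = v.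
Proof. by case: u v => [? ?] [? ?] /= -> ->. Qed.

Let umulA : associative umul.
Proof.
move=> [a k] [b l] [c m]; apply: upair_eq; last exact: mulrA.
rewrite /= !(cmulDl, cmulDr, scalerDr, cmulZl, cmulZr, scalerA) cmulA.
rewrite -!addrA; congr (_ + _).
rewrite [m * k]mulrC [m * l]mulrC [X in _ + X]addrCA [LHS]addrCA.
by congr (_ + (_ + _)); rewrite addrCA.
Qed.

Let umul1l : left_id uone umul.
Proof.
by move=> [a k]; apply: upair_eq; rewrite /= ?mul1r // cmul0l add0r scale1r scaler0 addr0.
Qed.

Let umul1r : right_id uone umul.
Proof.
by move=> [a k]; apply: upair_eq; rewrite /= ?mulr1 // cmul0r add0r scale1r scaler0 add0r.
Qed.

Let umulDl : left_distributive umul +%R.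
Proof.
move=> [a k] [b l] [c m]; apply: upair_eq; last exact: mulrDl.
rewrite /= cmulDl scalerDl scalerDr [X in X + _]addrACA.
by rewrite [LHS]addrACA.
Qed.

Let umulDr : right_distributive umul +%R.
Proof.
move=> [a k] [b l] [c m]; apply: upair_eq; last exact: mulrDr.
rewrite /= cmulDr scalerDl scalerDr [X in X + _]addrACA.
by rewrite [LHS]addrACA.
Qed.

Let uone_neq0 : uone != 0.
Proof. by apply/eqP => -[/eqP]; rewrite oner_eq0. Qed.

HB.instance Definition _ := GRing.Zmodule_isNzRing.Build U
  umulA umul1l umul1r umulDl umulDr uone_neq0.

Let uscaleAl (l : R[i]) (u v : U) : l *: (u * v) = l *: u * v.
Proof.
apply: upair_eq; last exact: mulrA.
by rewrite /= !scalerDr cmulZl !scalerA [v.2 * l]mulrC.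
Qed.

HB.instance Definition _ := GRing.Lmodule_isLalgebra.Build R[i] U uscaleAl.

Let uscaleAr (l : R[i]) (u v : U) : l *: (u * v) = u * (l *: v).
Proof.
apply: upair_eq; last exact: mulrCA.
by rewrite /= !scalerDr cmulZr !scalerA [u.2 * l]mulrC.
Qed.

HB.instance Definition _ := GRing.Lalgebra_isAlgebra.Build R[i] U uscaleAr.

End UnitizationRing.

(** * The operator norm on the unitization *)

Section UnitizationNorm.
Context (R : realType) (A : cstarAlgebra R).
Local Notation U := (unitization A).
Local Notation "a ** b" := (cmul a b) (at level 40, left associativity).
Implicit Types (a b : A) (u v : U).

Let uact u b : A := u.1 ** b + u.2 *: b.

Definition ustar u : U := (cstar u.1, Num.conj u.2).

(** The operator norm of [u] acting on [A] by left multiplication. *)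
Definition unorm u : R := sup [set cnorm (uact u b) | b in [set b | cnorm b <= 1]].

Let cnorm0 : cnorm (0 : A) = 0.
Proof. by rewrite -(scale0r (0 : A)) cnorm_scale normr0 mul0r. Qed.

Let cnormN a : cnorm (- a) = cnorm a.
Proof. by rewrite -scaleN1r cnorm_scale normrN1 mul1r. Qed.

Let cnorm_nonneg a : 0 <= cnorm a.
Proof. by have := cnorm_add a (- a); rewrite subrr cnorm0 cnormN; lra. Qed.

Let cnorm_scaleC (t : R) a : cnorm (t%:C *: a) = `|t| * cnorm a.
Proof. by rewrite cnorm_scale Re_normc_real. Qed.

Let cnorm_star_le a : cnorm a <= cnorm (cstar a).
Proof.
have [->|a0] := eqVneq (cnorm a) 0; first exact: cnorm_nonneg.
have a1 : 0 < cnorm a by rewrite lt_def a0 cnorm_nonneg.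
by rewrite -(ler_pM2r a1) -expr2 -cnorm_cstar cnorm_mul.
Qed.

Lemma cnorm_cstar_invol a : cnorm (cstar a) = cnorm a.
Proof.
by apply/eqP; rewrite eq_le cnorm_star_le -{2}(cstar_invol a) cnorm_star_le.
Qed.

Let uactZ u (l : R[i]) b : uact u (l *: b) = l *: uact u b.
Proof. by rewrite /uact cmulZr scalerDr !scalerA mulrC. Qed.

Let uact_bound u b :
  cnorm (uact u b) <= (cnorm u.1 + complex.Re `|u.2|) * cnorm b.
Proof.
rewrite /uact; apply: le_trans (cnorm_add _ _) _.
by rewrite mulrDl lerD ?cnorm_mul // cnorm_scale.
Qed.

Let Re_norm_ge0 (l : R[i]) : 0 <= complex.Re `|l|.
Proof. by rewrite normc_def /= sqrtr_ge0. Qed.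

Let uact_has_ubound u :
  has_ubound [set cnorm (uact u b) | b in [set b | cnorm b <= 1]].
Proof.
exists (cnorm u.1 + complex.Re `|u.2|) => _ [b /= b1 <-].
apply: le_trans (uact_bound u b) _.
by rewrite ler_piMr // addr_ge0 ?cnorm_nonneg.
Qed.

Let unorm_le u (M : R) :
  (forall b, cnorm b <= 1 -> cnorm (uact u b) <= M) -> unorm u <= M.
Proof.
move=> H; apply: ge_sup; first by exists (cnorm (uact u 0)), 0; rewrite //= cnorm0.
by move=> _ [b /= b1 <-]; exact: H.
Qed.

Let uact_le_unorm u b : cnorm (uact u b) <= unorm u * cnorm b.
Proof.
have [b0|b0] := eqVneq (cnorm b) 0.
  by apply: le_trans (uact_bound u b) _; rewrite b0 !mulr0.
have b1 : 0 < cnorm b by rewrite lt_def b0 cnorm_nonneg.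
rewrite -ler_pdivrMr // mulrC -[(cnorm b)^-1]gtr0_norm ?invr_gt0 //.
rewrite -cnorm_scaleC -uactZ; apply: ub_le_sup; first exact: uact_has_ubound.
exists ((cnorm b)^-1%:C *: b) => //=.
by rewrite cnorm_scaleC gtr0_norm ?invr_gt0 // mulVf.
Qed.

Let unorm_ge0 u : 0 <= unorm u.
Proof.
apply: le_trans (cnorm_nonneg (uact u 0)) _.
by apply: ub_le_sup; [exact: uact_has_ubound|exists 0; rewrite //= cnorm0].
Qed.

Let uactM u v b : uact (u * v) b = uact u (uact v b).
Proof.
rewrite /uact /= !cmulDl !cmulDr !cmulZl cmulZr cmulA !scalerDr scalerA -!addrA.
by congr (_ + _); rewrite addrCA.
Qed.

Let uact_ustar u b :
  cstar (uact u b) ** uact u b = cstar b ** uact (ustar u * u) b.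
Proof.
rewrite uactM /uact /= cstar_add cstar_mul cstar_scale.
by rewrite [in RHS]cmulDr cmulZr cmulA -cmulZl -cmulDl.
Qed.

(** Bounds are tested on the unit ball of [A]. From [(u b)^* (u b) = b^* (u^* u b)] one gets
    [unorm u ^+ 2 <= unorm (u^* u)]; this forces the involution to be isometric, and
    submultiplicativity gives the converse. *)
Lemma unitization_isCstarSeminorm : isCstarSeminorm ustar unorm.
Proof.
have sq u : unorm u ^+ 2 <= unorm (ustar u * u).
  rewrite -(sqr_sqrtr (unorm_ge0 (ustar u * u))) ler_sqr ?nnegrE ?sqrtr_ge0 //.
  apply: unorm_le => b b1.
  rewrite -[leLHS]ger0_norm // -sqrtr_sqr; apply: ler_wsqrtr.
  rewrite -cnorm_cstar uact_ustar.
  apply: le_trans (cnorm_mul _ _) _.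
  rewrite cnorm_cstar_invol -[leRHS]mul1r ler_pM //.
  by apply: le_trans (uact_le_unorm _ _) _; rewrite ler_piMr.
have uM u v : unorm (u * v) <= unorm u * unorm v.
  apply: unorm_le => b b1; rewrite uactM; apply: le_trans (uact_le_unorm _ _) _.
  rewrite ler_wpM2l //; apply: le_trans (uact_le_unorm _ _) _.
  by rewrite ler_piMr.
have starK u : ustar (ustar u) = u.
  by case: u => a k; rewrite /ustar /= cstar_invol conjCK.
have star_le u : unorm u <= unorm (ustar u).
  have [->|u0] := eqVneq (unorm u) 0; first exact: unorm_ge0.
  have u1 : 0 < unorm u by rewrite lt_def u0 unorm_ge0.
  by rewrite -(ler_pM2r u1) -expr2 (le_trans (sq u)).
split=> //.
- by move=> [a k] [b l]; rewrite /ustar /= cstar_add rmorphD.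
- move=> [a k] [b l]; rewrite /ustar /= !cstar_add cstar_mul !cstar_scale.
  congr pair; last by rewrite rmorphM mulrC.
  by rewrite -!addrA; congr (_ + _); rewrite addrC.
- by move=> l [a k]; rewrite /ustar /= cstar_scale rmorphM.
- move=> u v; apply: unorm_le => b b1.
  have -> : uact (u + v) b = uact u b + uact v b.
    by rewrite /uact /= cmulDl scalerDl addrACA.
  apply: le_trans (cnorm_add _ _) (lerD _ _).
    by apply: le_trans (uact_le_unorm _ _) _; rewrite ler_piMr.
  by apply: le_trans (uact_le_unorm _ _) _; rewrite ler_piMr.
- have H l u : unorm (l *: u) <= complex.Re `|l| * unorm u.
    apply: unorm_le => b b1.
    have -> : uact (l *: u) b = l *: uact u b.
      by rewrite /uact /= cmulZl scalerDr scalerA.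
    rewrite cnorm_scale ler_wpM2l //.
    by apply: le_trans (uact_le_unorm _ _) _; rewrite ler_piMr.
  move=> l u; apply/eqP; rewrite eq_le H andTb.
  have nE k : complex.Re `|k : R[i]| = Normc.normc k by rewrite normc_def; case: k.
  have [->|l0] := eqVneq l 0; first by rewrite normr0 mul0r.
  have l1 : 0 < complex.Re `|l|.
    by rewrite lt_def Re_norm_ge0 andbT nE; apply/eqP => /Normc.eq0_normc/eqP; apply/negP.
  rewrite -ler_pdivlMl //.
  (* The reverse inequality is the same bound for the scalar [l^-1] at [l *: u]. *)
  have := H l^-1 (l *: u); rewrite scalerA mulVf // scale1r.
  by rewrite !nE Normc.normcV.
- move=> u; apply/eqP; rewrite eq_le sq andbT; apply: le_trans (uM _ _) _.
  by rewrite expr2 ler_wpM2r // -{2}(starK u).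
- apply: unorm_le => b b1.
  by rewrite /uact /= cmul0l add0r scale1r.
Qed.

Definition unit_inj a : U := (a, 0).

(** The lower bound comes from testing on [cstar a], as [a a^*] has norm [cnorm a ^+ 2]. *)
Lemma unorm_inj a : unorm (unit_inj a) = cnorm a.
Proof.
have actE b : uact (unit_inj a) b = a ** b by rewrite /uact /= scale0r addr0.
apply/eqP; rewrite eq_le; apply/andP; split.
  apply: unorm_le => b b1; rewrite actE; apply: le_trans (cnorm_mul _ _) _.
  by rewrite ler_piMr.
have [->|a0] := eqVneq (cnorm a) 0; first exact: unorm_ge0.
have a1 : 0 < cnorm a by rewrite lt_def a0 cnorm_nonneg.
rewrite -(ler_pM2r a1) -expr2 -cnorm_cstar_invol -cnorm_cstar cstar_invol -actE.
exact: uact_le_unorm.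
Qed.

(** Positivity compares with multiples of a unit, so it is read in the unitization. *)
Definition apos a : Prop := cpos ustar unorm (unit_inj a).

Lemma aposD a b : apos a -> apos b -> apos (a + b).
Proof.
have -> : apos (a + b) = cpos ustar unorm (unit_inj a + unit_inj b).
  by congr cpos; apply/eqP; rewrite xpair_eqE /= addr0 !eqxx.
exact: (cposD unitization_isCstarSeminorm).
Qed.

Lemma aposZ (r : R) a : 0 <= r -> apos a -> apos (r%:C *: a).
Proof.
move=> r0; have -> : apos (r%:C *: a) = cpos ustar unorm (r%:C *: unit_inj a).
  by congr cpos; apply/eqP; rewrite xpair_eqE /= scaler0 !eqxx.
exact: (cposZ unitization_isCstarSeminorm).
Qed.

Lemma apos_cstar_mul a : apos (cstar a ** a).
Proof.
have -> : apos (cstar a ** a) = cpos ustar unorm (ustar (unit_inj a) * unit_inj a).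
  congr cpos; apply/eqP; rewrite xpair_eqE /= conjC0 !scale0r !addr0 mulr0.
  by rewrite !eqxx.
exact: (cpos_star_mul unitization_isCstarSeminorm).
Qed.

Lemma apos0 : apos 0.
Proof. by rewrite -(cmul0r (cstar 0)); exact: apos_cstar_mul. Qed.

Lemma cnorm_le_aposD a b : apos a -> apos b -> cnorm a <= cnorm (a + b).
Proof.
move=> pa pb; rewrite -!unorm_inj.
have -> : unit_inj (a + b) = unit_inj a + unit_inj b.
  by apply/eqP; rewrite xpair_eqE /= addr0 !eqxx.
exact: (cnorm_le_cposD unitization_isCstarSeminorm).
Qed.

End UnitizationNorm.

(** * The fibres of a Fell bundle *)

Section GroupoidTheory.
Context (G : etaleGroupoid).
Implicit Types g h k x : G.

Let GA := etale_groupoid G.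

Lemma src_inv g : src (ginv g) = grng (@gmul G) (@ginv G) g.
Proof. by rewrite /src /gsrc (groupoid_invK GA). Qed.

Lemma rng_inv g : grng (@gmul G) (@ginv G) (ginv g) = src g.
Proof. by rewrite /grng (groupoid_invK GA). Qed.

Lemma composable_inv_l g : composable (ginv g) g.
Proof. exact: src_inv. Qed.

Lemma composable_inv_r g : composable g (ginv g).
Proof. by rewrite /composable /gcomposable rng_inv. Qed.

Lemma src_src g : src (src g) = src g.
Proof. exact: (groupoid_src_mul GA (composable_inv_l g)). Qed.

Lemma rng_src g : grng (@gmul G) (@ginv G) (src g) = src g.
Proof. by rewrite {1}/src (groupoid_rng_mul GA (composable_inv_l g)) rng_inv. Qed.

Lemma composable_src g : composable g (src g).
Proof. by rewrite /composable /gcomposable rng_src. Qed.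

Lemma gmul_src g : gmul g (src g) = g.
Proof. exact: (groupoid_mul_src GA). Qed.

Lemma unit_src x : units G x -> src x = x.
Proof. by case=> g _ <-; exact: src_src. Qed.

Lemma unit_composable x : units G x -> composable x x.
Proof. by move=> ux; have := composable_src x; rewrite unit_src. Qed.

Lemma unit_mul x : units G x -> gmul x x = x.
Proof. by move=> ux; have := gmul_src x; rewrite unit_src. Qed.

Lemma unit_inv x : units G x -> ginv x = x.
Proof.
move=> ux; have := gmul_src (ginv x).
have -> : src (ginv x) = x.
  by rewrite src_inv -{1}(unit_src ux) rng_src unit_src.
by rewrite -[X in X = _]/(src x) unit_src.
Qed.

(** The right factor and the product determine the left factor, so a finitely supported [f] leaves
    finitely many terms in a convolution. *)
Lemma gmul_invr_eq g h k : composable g h -> gmul g h = k -> g = gmul k (ginv h).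
Proof.
move=> gh <-; rewrite (groupoid_mulA GA gh (composable_inv_r h)).
by rewrite -[gmul h _]/(grng (@gmul G) (@ginv G) h) -gh gmul_src.
Qed.

End GroupoidTheory.

Section FibreNorm.
Context (R : realType) (X : topologicalType) (rho : bundleData R X).
Implicit Types (x : X).

Lemma normrE_fnorm x (v : fib rho x) : `|v| = (fnorm v)%:C.
Proof. by rewrite /fnorm RRe_real // normr_real. Qed.

Lemma fnorm_ge0 x (v : fib rho x) : 0 <= fnorm v.
Proof. by rewrite -ler0c -normrE_fnorm. Qed.

Lemma fnorm0 x : fnorm (0 : fib rho x) = 0.
Proof. by rewrite /fnorm normr0. Qed.

Lemma fnorm0_eq0 x (v : fib rho x) : fnorm v = 0 -> v = 0.
Proof. by move=> v0; apply: normr0_eq0; rewrite normrE_fnorm v0. Qed.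

Lemma fnormD x (v w : fib rho x) : fnorm (v + w) <= fnorm v + fnorm w.
Proof. by rewrite -lecR rmorphD /= -!normrE_fnorm ler_normD. Qed.

Lemma fnormZ x (l : R[i]) (v : fib rho x) :
  fnorm (l *: v) = complex.Re `|l| * fnorm v.
Proof.
rewrite {1}/fnorm normrZ normrE_fnorm; case: (`|l|) => a b /=.
by rewrite mulr0 subr0.
Qed.

Lemma fnormZr x (t : R) (v : fib rho x) : fnorm (t%:C *: v) = `|t| * fnorm v.
Proof. by rewrite fnormZ Re_normc_real. Qed.

Lemma fnorm_sum x (I : Type) (s : seq I) (F : I -> fib rho x) :
  fnorm (\sum_(i <- s) F i) <= \sum_(i <- s) fnorm (F i).
Proof.
elim/big_ind2: _ => // [|v r w t H1 H2]; first by rewrite fnorm0.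
exact: le_trans (fnormD _ _) (lerD H1 H2).
Qed.

End FibreNorm.

Section BundleCoordinates.
Context (R : realType) (X : topologicalType) (rho : banachBundle R X).
Implicit Types (x : X) (b c : tot rho).

Let BA := bundle_axioms rho.

Lemma proj_inc x (v : fib rho x) : proj (inc v) = x.
Proof.
have : range (@inc _ _ rho x) (inc v) by exists v.
by rewrite (bundle_inc_range BA).
Qed.

Lemma inc_coord x b : proj b = x -> inc (coord x b) = b.
Proof.
move=> bx; have : range (@inc _ _ rho x) b by rewrite (bundle_inc_range BA).
by case=> v _ vb; rewrite /coord; apply: (@xgetPex _ 0 [set v | inc v = b]); exists v.
Qed.

Lemma coord_inc x (v : fib rho x) : coord x (inc v) = v.
Proof. by apply: (bundle_inc_inj BA); rewrite inc_coord ?proj_inc. Qed.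

Lemma baddE x b c : proj b = x -> badd b c = inc (coord x b + coord x c).
Proof. by move=> <-. Qed.

Lemma bscaleE x (l : R[i]) b : proj b = x -> bscale l b = inc (l *: coord x b).
Proof. by move=> <-. Qed.

Lemma bnormE x b : proj b = x -> bnorm b = fnorm (coord x b).
Proof. by move=> <-. Qed.

Lemma badd_inc x (v w : fib rho x) : badd (inc v) (inc w) = inc (v + w).
Proof. by rewrite (baddE _ (proj_inc v)) !coord_inc. Qed.

Lemma bscale_inc x (l : R[i]) (v : fib rho x) : bscale l (inc v) = inc (l *: v).
Proof. by rewrite (bscaleE _ (proj_inc v)) coord_inc. Qed.

Lemma bnorm_inc x (v : fib rho x) : bnorm (inc v) = fnorm v.
Proof. by rewrite (bnormE (proj_inc v)) coord_inc. Qed.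

End BundleCoordinates.

(** * Products, adjoints and inner products between fibres *)

Section FibreOperations.
Context (R : realType) (G : etaleGroupoid) (rho : fellBundle R G).
Implicit Types g h k p q x : G.

Let FA := fell_axioms rho.
Let SSA := fell_star_semigroupoid FA.

(** The target [k] is a free parameter, meaningful when it equals [gmul g h]: fibres over provably
    equal points, such as [gmul x x] and [x], then require no transport. *)
Definition fmul g h k (v : fib rho g) (w : fib rho h) : fib rho k :=
  coord k (bmul (inc v) (inc w)).

Definition fstar g k (v : fib rho g) : fib rho k := coord k (bstar (inc v)).

Lemma bdef_inc g h (v : fib rho g) (w : fib rho h) :
  composable g h -> bdef (inc v) (inc w).
Proof. by rewrite /bdef !proj_inc. Qed.

Lemma inc_fmul g h k (v : fib rho g) (w : fib rho h) :
  composable g h -> gmul g h = k -> inc (fmul k v w) = bmul (inc v) (inc w).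
Proof.
by move=> gh ghk; rewrite inc_coord // (fell_proj_mul FA) ?proj_inc //; exact: bdef_inc.
Qed.

Lemma inc_fstar g k (v : fib rho g) :
  ginv g = k -> inc (fstar k v) = bstar (inc v).
Proof. by move=> gk; rewrite inc_coord // (fell_proj_star FA) proj_inc. Qed.

Section FmulLinear.
Context (g h k : G) (gh : composable g h) (ghk : gmul g h = k).

Lemma fmulDl (v v' : fib rho g) (w : fib rho h) :
  fmul k (v + v') w = fmul k v w + fmul k v' w.
Proof.
apply: (bundle_inc_inj (bundle_axioms rho)); rewrite inc_fmul // -badd_inc.
rewrite (fell_mulDl FA) ?proj_inc //; last exact: bdef_inc.
by rewrite -!(inc_fmul _ _ gh ghk) badd_inc.
Qed.

Lemma fmulDr (v : fib rho g) (w w' : fib rho h) :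
  fmul k v (w + w') = fmul k v w + fmul k v w'.
Proof.
apply: (bundle_inc_inj (bundle_axioms rho)); rewrite inc_fmul // -badd_inc.
rewrite (fell_mulDr FA) ?proj_inc //; last exact: bdef_inc.
by rewrite -!(inc_fmul _ _ gh ghk) badd_inc.
Qed.

Lemma fmulZl (l : R[i]) (v : fib rho g) (w : fib rho h) :
  fmul k (l *: v) w = l *: fmul k v w.
Proof.
apply: (bundle_inc_inj (bundle_axioms rho)); rewrite inc_fmul // -bscale_inc.
rewrite (fell_mulZl FA); last exact: bdef_inc.
by rewrite -!(inc_fmul _ _ gh ghk) bscale_inc.
Qed.

Lemma fmulZr (l : R[i]) (v : fib rho g) (w : fib rho h) :
  fmul k v (l *: w) = l *: fmul k v w.
Proof.
apply: (bundle_inc_inj (bundle_axioms rho)); rewrite inc_fmul // -bscale_inc.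
rewrite (fell_mulZr FA); last exact: bdef_inc.
by rewrite -!(inc_fmul _ _ gh ghk) bscale_inc.
Qed.

Lemma fnorm_fmul (v : fib rho g) (w : fib rho h) :
  fnorm (fmul k v w) <= fnorm v * fnorm w.
Proof.
rewrite -!bnorm_inc inc_fmul //; apply: (fell_norm_mul FA); exact: bdef_inc.
Qed.

Lemma fmul0r (v : fib rho g) : fmul k v (0 : fib rho h) = 0.
Proof. by rewrite -[X in fmul k _ X](scale0r (0 : fib rho h)) fmulZr scale0r. Qed.

End FmulLinear.

Section FstarLinear.
Context (g k : G) (gk : ginv g = k).

Lemma fstarD (v w : fib rho g) : fstar k (v + w) = fstar k v + fstar k w.
Proof.
apply: (bundle_inc_inj (bundle_axioms rho)); rewrite inc_fstar // -badd_inc.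
by rewrite (fell_starD FA) ?proj_inc // -!(inc_fstar _ gk) badd_inc.
Qed.

Lemma fstarZ (l : R[i]) (v : fib rho g) :
  fstar k (l *: v) = Num.conj l *: fstar k v.
Proof.
apply: (bundle_inc_inj (bundle_axioms rho)); rewrite inc_fstar // -bscale_inc.
by rewrite (fell_starZ FA) -!(inc_fstar _ gk) bscale_inc.
Qed.

End FstarLinear.

Section FibreAlgebra.
Context (x : G) (ux : units G x).
Local Notation A := (fib rho x : lmodType R[i]).

Let xx := unit_composable ux.
Let xm := unit_mul ux.
Let xi := unit_inv ux.

Let mulA : associative (fmul x : A -> A -> A).
Proof.
move=> a b c; apply: (bundle_inc_inj (bundle_axioms rho)).
rewrite !(inc_fmul _ _ xx xm) (semigroupoid_mulA (star_semigroupoid SSA)) //.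
  exact: bdef_inc.
by rewrite -(inc_fmul _ _ xx xm); exact: bdef_inc.
Qed.

Let starK : involutive (fstar x : A -> A).
Proof.
move=> a; apply: (bundle_inc_inj (bundle_axioms rho)).
by rewrite !(inc_fstar _ xi) (star_semigroupoidK SSA).
Qed.

Let starM (a b : A) : fstar x (fmul x a b : A) = fmul x (fstar x b : A) (fstar x a : A) :> A.
Proof.
apply: (bundle_inc_inj (bundle_axioms rho)).
rewrite (inc_fstar _ xi) !(inc_fmul _ _ xx xm) !(inc_fstar _ xi).
by have [] := star_semigroupoidM SSA (bdef_inc a b xx).
Qed.

Let norm_star_mul (a : A) : fnorm (fmul x (fstar x a : A) a : fib rho x) = fnorm a ^+ 2.
Proof.
by rewrite -!bnorm_inc (inc_fmul _ _ xx xm) (inc_fstar _ xi) (fell_norm_star_mul FA).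
Qed.

(** Over a unit, product and involution stay inside one fibre. *)
Definition fibreAlgebra : cstarAlgebra R :=
  @CstarAlgebra R A (fmul x) (fstar x) (@fnorm R G rho x) mulA
    (fun a b c => fmulDl xx xm a b c) (fun a b c => fmulDr xx xm a b c)
    (fun l a b => fmulZl xx xm l a b) (fun l a b => fmulZr xx xm l a b)
    starK (fstarD xi) starM (fstarZ xi)
    (@fnormD R G rho x) (@fnormZ R G rho x)
    (fun a b => fnorm_fmul xx xm a b) norm_star_mul.

End FibreAlgebra.

(** The inner product [v^* w] with values in the fibre over the source, in the very shape of the
    summands of [norm2_partial]. *)
Definition finner g x (v w : fib rho g) : fib rho x :=
  coord x (bmul (bstar (inc v)) (inc w)).

Section Finner.
Context (g x : G) (gx : src g = x).
Implicit Types v w : fib rho g.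

Lemma finner_fmul v w : finner x v w = fmul x (fstar (ginv g) v) w.
Proof. by rewrite /fmul inc_fstar. Qed.

Let cg := composable_inv_l g.

Lemma finnerDl v v' w : finner x (v + v') w = finner x v w + finner x v' w.
Proof. by rewrite !finner_fmul fstarD // (fmulDl cg gx). Qed.

Lemma finnerDr v w w' : finner x v (w + w') = finner x v w + finner x v w'.
Proof. by rewrite !finner_fmul (fmulDr cg gx). Qed.

Lemma finnerZl (l : R[i]) v w : finner x (l *: v) w = Num.conj l *: finner x v w.
Proof. by rewrite !finner_fmul fstarZ // (fmulZl cg gx). Qed.

Lemma finnerZr (l : R[i]) v w : finner x v (l *: w) = l *: finner x v w.
Proof. by rewrite !finner_fmul (fmulZr cg gx). Qed.

Lemma finnerZZ (l : R[i]) v :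
  finner x (l *: v) (l *: v) = (`|l| ^+ 2) *: finner x v v.
Proof. by rewrite finnerZl finnerZr scalerA normCK mulrC. Qed.

Lemma fnorm_finner v : fnorm (finner x v v) = fnorm v ^+ 2.
Proof.
rewrite -!bnorm_inc finner_fmul (inc_fmul _ _ cg gx) inc_fstar //.
exact: (fell_norm_star_mul FA).
Qed.

(** For a general [g] the vector [v] lies outside the algebra over [x]. The axiom [fell_positive]
    replaces it by some [c] over [x] with [c^* c = v^* v], to which Kaplansky's theorem applies. *)
Lemma apos_finner (ux : units G x) v : apos (finner x v v : fibreAlgebra ux).
Proof.
have pE : proj (bmul (bstar (inc v)) (inc v)) = x.
  rewrite -(inc_fstar _ (erefl (ginv g))) -(inc_fmul _ _ cg gx); exact: proj_inc.
have [c [pc cE]] := fell_positive FA (inc v).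
have -> : finner x v v = cmul (cstar (coord x c : fibreAlgebra ux)) (coord x c).
  rewrite /= /finner -cE /fmul inc_fstar ?unit_inv // inc_coord //.
  by rewrite pc pE.
exact: apos_cstar_mul.
Qed.

End Finner.

End FibreOperations.

(** * The Minkowski inequality for [norm2_partial] *)


Lemma sum_sqr_le (R : realDomainType) (I : Type) (s : seq I) (f : I -> R) :
  (forall i, 0 <= f i) ->
  \sum_(i <- s) f i ^+ 2 <= (\sum_(i <- s) f i) ^+ 2.
Proof.
move=> f0; elim: s => [|i s IH]; first by rewrite !big_nil expr0n.
rewrite !big_cons sqrrD -addrA lerD2l (le_trans IH) // lerDr.
by rewrite mulrn_wge0 // mulr_ge0 // sumr_ge0.
Qed.

Section PartialNorm.
Context (R : realType) (G : etaleGroupoid) (rho : fellBundle R G).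
Implicit Types a b c : sections rho.

(* The coefficients are chosen so that the cross terms cancel. *)
Lemma finner_parallelogram (g x : G) (gx : src g = x) (r t : R) (v w : fib rho g) :
  (r * t)%:C *: finner x (v + w) (v + w) +
    finner x (t%:C *: v + (- r)%:C *: w) (t%:C *: v + (- r)%:C *: w) =
  (r + t)%:C *: (t%:C *: finner x v v + r%:C *: finner x w w).
Proof.
rewrite !(finnerDl gx) !(finnerDr gx) !(finnerZl gx) !(finnerZr gx) !conj_realC.
rewrite !scalerDr !scalerA -!rmorphM /= addrACA.
rewrite [X in X + _ = _]addrACA [X in _ + X = _]addrACA -!scalerDl -!rmorphD /=.
have -> : r * t + t * - r = 0 by ring.
have -> : r * t + - r * t = 0 by ring.
rewrite !scale0r addr0 add0r.
by congr (_%:C *: _ + _%:C *: _); ring.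
Qed.

Context (x : G) (F : set G) (ux : units G x)
  (Fx : fsets [set g : G | src g = x] F).

Let sq a : fib rho x := (\sum_(g \in F) finner x (a g) (a g))%R.

Let sqE a : sq a = \sum_(g <- fset_set F) finner x (a g) (a g).
Proof. by apply: fsbig_finite; case: Fx. Qed.

Let src_fset g : g \in fset_set F -> src g = x.
Proof. by have [Ff FS] := Fx; rewrite in_fset_set // inE => /FS. Qed.

Lemma norm2_partialE a : norm2_partial a x F = Num.sqrt (fnorm (sq a)).
Proof. by []. Qed.

Let apos_sq a : apos (sq a : fibreAlgebra rho ux).
Proof.
rewrite sqE big_seq; elim/big_ind: _; first exact: apos0.
  exact: (@aposD _ (fibreAlgebra rho ux)).
by move=> g /src_fset gx; exact: apos_finner.
Qed.

Let sq_parallelogram (r t : R) a b :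
  (r * t)%:C *: sq (a + b) + sq (t%:C *: a + (- r)%:C *: b) =
  (r + t)%:C *: (t%:C *: sq a + r%:C *: sq b).
Proof.
rewrite !sqE !scaler_sumr -!big_split /= scaler_sumr !big_seq.
by apply: eq_bigr => g /src_fset gx; exact: finner_parallelogram.
Qed.

Let sqZ (l : R[i]) a : sq (l *: a) = (`|l| ^+ 2) *: sq a.
Proof.
rewrite !sqE scaler_sumr !big_seq; apply: eq_bigr => g /src_fset gx.
exact: finnerZZ.
Qed.

Lemma norm2_partial_ge0 a : 0 <= norm2_partial a x F.
Proof. exact: sqrtr_ge0. Qed.

Lemma norm2_partialZ (l : R[i]) a :
  norm2_partial (l *: a) x F = complex.Re `|l| * norm2_partial a x F.
Proof.
have l0 : 0 <= complex.Re `|l| by rewrite normc_def /= sqrtr_ge0.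
rewrite !norm2_partialE sqZ fnormZ -{1}(RRe_real (normr_real l)).
rewrite -rmorphXn Re_normc_real sqrtrM ?normr_ge0 // normrX ger0_norm //.
by rewrite sqrtr_sqr ger0_norm.
Qed.

Lemma norm2_partialD a b :
  norm2_partial (a + b) x F <= norm2_partial a x F + norm2_partial b x F.
Proof.
apply/ler_addgt0Pr => e e0.
(* The added [e / 2] makes [r] and [t] positive, so that [r * t] can be cancelled. *)
pose r := norm2_partial a x F + e / 2; pose t := norm2_partial b x F + e / 2.
have e2 : 0 < e / 2 by rewrite divr_gt0.
have r0 : 0 < r by rewrite ltr_wpDl // norm2_partial_ge0.
have t0 : 0 < t by rewrite ltr_wpDl // norm2_partial_ge0.
have bound c (u : R) : norm2_partial c x F <= u -> fnorm (sq c) <= u ^+ 2.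
  move=> cu; rewrite -[leLHS]sqr_sqrtr ?fnorm_ge0 //.
  by rewrite ler_sqr ?nnegrE ?sqrtr_ge0 // (le_trans _ cu) // norm2_partial_ge0.
have Ha : fnorm (sq a) <= r ^+ 2 by apply: bound; rewrite lerDl ltW.
have Hb : fnorm (sq b) <= t ^+ 2 by apply: bound; rewrite lerDl ltW.
have rt0 : 0 < r * t by rewrite mulr_gt0.
(* The second square in the parallelogram identity is positive; monotonicity of the norm allows
   dropping it. *)
have H : fnorm ((r * t)%:C *: sq (a + b)) <=
    fnorm ((r + t)%:C *: (t%:C *: sq a + r%:C *: sq b)).
  rewrite -sq_parallelogram; apply: (@cnorm_le_aposD _ (fibreAlgebra rho ux)) => //.
  by apply: aposZ => //; exact: ltW.
move: H; rewrite !fnormZr (gtr0_norm rt0) (gtr0_norm (addr_gt0 r0 t0)) => H.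
have H1 : fnorm (t%:C *: sq a + r%:C *: sq b) <= t * r ^+ 2 + r * t ^+ 2.
  apply: le_trans (fnormD _ _) _; rewrite !fnormZr !gtr0_norm //.
  by rewrite lerD // ler_pM2l.
have H2 : fnorm (sq (a + b)) <= (r + t) ^+ 2.
  rewrite -(ler_pM2l rt0); apply: le_trans H _.
  have -> : r * t * (r + t) ^+ 2 = (r + t) * (t * r ^+ 2 + r * t ^+ 2) by ring.
  by rewrite ler_pM2l // addr_gt0.
have -> : norm2_partial a x F + norm2_partial b x F + e = r + t.
  by rewrite /r /t; field.
have rt1 : 0 <= r + t by rewrite ltW // addr_gt0.
rewrite norm2_partialE -(ger0_norm rt1) -sqrtr_sqr.
exact: ler_wsqrtr.
Qed.

(** A crude bound through [sum_sqr_le], which turns smallness of finitely many values into smallness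
    of the partial norm. *)
Lemma norm2_partial_le_sum a :
  norm2_partial a x F <= \sum_(g <- fset_set F) fnorm (a g).
Proof.
have S0 : 0 <= \sum_(g <- fset_set F) fnorm (a g).
  by apply: sumr_ge0 => g _; exact: fnorm_ge0.
rewrite norm2_partialE -[leRHS]ger0_norm // -sqrtr_sqr; apply: ler_wsqrtr.
rewrite sqE; apply: le_trans (fnorm_sum _ _) _.
rewrite (_ : \sum_(g <- _) _ = \sum_(g <- fset_set F) fnorm (a g) ^+ 2).
  by apply: sum_sqr_le => g; exact: fnorm_ge0.
rewrite !big_seq; apply: eq_bigr => g /src_fset gx; exact: fnorm_finner.
Qed.

End PartialNorm.

(** * The norms [norm2] and [normb] *)


Section Norms.
Context (R : realType) (G : etaleGroupoid) (rho : fellBundle R G).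
Implicit Types (a b f : sections rho) (g h x : G).
Local Open Scope ereal_scope.

Let FA := fell_axioms rho.
Let SSA := fell_star_semigroupoid FA.

Lemma Re_norm_ge0 (l : R[i]) : (0 <= complex.Re `|l|)%R.
Proof. by rewrite normc_def /= sqrtr_ge0. Qed.

Lemma norm2_ge0 a : 0 <= norm2 a.
Proof. by apply: ereal_sup_ubound; left. Qed.

Lemma norm2_partial_le a x F : units G x -> fsets [set g : G | src g = x] F ->
  (norm2_partial a x F)%:E <= norm2 a.
Proof.
move=> ux Fx; apply: le_trans (_ : ereal_sup
   [set (norm2_partial a x F)%:E | F in fsets [set g : G | src g = x]] <= _).
  by apply: ereal_sup_ubound; exists F.
by apply: ereal_sup_ubound; right; exists x.
Qed.

Lemma norm2_le a (M : \bar R) : 0 <= M ->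
  (forall x F, units G x -> fsets [set g : G | src g = x] F ->
    (norm2_partial a x F)%:E <= M) -> norm2 a <= M.
Proof.
move=> M0 H; apply: ge_ereal_sup => _ [-> //|[x ux <-]].
by apply: ge_ereal_sup => _ [F Fx <-]; exact: H.
Qed.

Lemma norm2D a b : norm2 (a + b)%R <= norm2 a + norm2 b.
Proof.
apply: norm2_le => [|x F ux Fx]; first by rewrite adde_ge0 ?norm2_ge0.
apply: le_trans (_ : (norm2_partial a x F + norm2_partial b x F)%:E <= _).
  by rewrite lee_fin norm2_partialD.
by rewrite EFinD leeD // norm2_partial_le.
Qed.

Lemma norm2Z_le (l : R[i]) a : norm2 (l *: a)%R <= (complex.Re `|l|)%:E * norm2 a.
Proof.
have l0 : 0 <= (complex.Re `|l|)%:E by rewrite lee_fin Re_norm_ge0.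
apply: norm2_le => [|x F ux Fx]; first by rewrite mule_ge0 ?norm2_ge0.
by rewrite norm2_partialZ // EFinM lee_wpmul2l // norm2_partial_le.
Qed.

Lemma fnorm_le_norm2 a g : (fnorm (a g))%:E <= norm2 a.
Proof.
have ug : units G (src g) by exists g.
have Fg : fsets [set h : G | src h = src g] [set g].
  by split=> [|_ ->//]; exact: finite_set1.
apply: le_trans (norm2_partial_le a ug Fg); rewrite lee_fin norm2_partialE.
by rewrite fsbig_set1 fnorm_finner // sqrtr_sqr ler_norm.
Qed.

Lemma norm2_eq0 a : (forall g, a g = 0%R) -> norm2 a = 0.
Proof.
move=> a0; apply/eqP; rewrite eq_le norm2_ge0 andbT.
apply: norm2_le => // x F ux Fx; rewrite lee_fin.
apply: le_trans (norm2_partial_le_sum Fx a) _.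
by rewrite big1 // => g _; rewrite a0 fnorm0.
Qed.

Let conv_pairs f g : set (G * G) :=
  [set p | (composable p.1 p.2 /\ gmul p.1 p.2 = g) /\ f p.2 <> 0%R].

Let finite_conv_pairs f g : finitely_supported rho f -> finite_set (conv_pairs f g).
Proof.
move=> ff; apply: (sub_finite_set _ (finite_image (fun h => (gmul g (ginv h), h)) ff)).
move=> [p1 p2] /= [[p12 pg] fp]; exists p2 => //=.
by rewrite -(gmul_invr_eq p12 pg).
Qed.

Let convolutionE a f g : finitely_supported rho f ->
  convolution a f g =
  (\sum_(p <- fset_set (conv_pairs f g)) fmul g (a p.1) (f p.2))%R.
Proof.
move=> ff; rewrite -fsbig_finite; last exact: finite_conv_pairs.
apply/esym/fsbig_widen; first by move=> p [].
move=> p [[cp pg] np] /=; rewrite -[LHS]/(fmul g (a p.1) (f p.2)).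
have -> : f p.2 = 0%R by apply: contrapT => fp; apply: np.
by rewrite fmul0r.
Qed.

Let mem_conv_pairs f g p : finitely_supported rho f ->
  p \in fset_set (conv_pairs f g) -> composable p.1 p.2 /\ gmul p.1 p.2 = g.
Proof.
by move=> ff; rewrite in_fset_set ?inE; [case|exact: finite_conv_pairs].
Qed.

Lemma convolutionDl a b f : finitely_supported rho f ->
  convolution (a + b)%R f = (convolution a f + convolution b f)%R.
Proof.
move=> ff; apply: functional_extensionality_dep => g.
rewrite -[RHS]/(convolution a f g + convolution b f g)%R !convolutionE //.
rewrite -big_split !big_seq; apply: eq_bigr => p /(mem_conv_pairs ff)[cp pg].
exact: fmulDl.
Qed.

Lemma convolutionZl (l : R[i]) a f : finitely_supported rho f ->
  convolution (l *: a)%R f = (l *: convolution a f)%R.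
Proof.
move=> ff; apply: functional_extensionality_dep => g.
rewrite -[RHS]/(l *: convolution a f g)%R !convolutionE // scaler_sumr.
rewrite !big_seq; apply: eq_bigr => p /(mem_conv_pairs ff)[cp pg].
exact: fmulZl.
Qed.

(** The list [s] is independent of [a]: the value at [g] is controlled by the same finitely many
    values of every section. *)
Lemma fnorm_convolution_le f g : finitely_supported rho f ->
  exists s : seq (G * G), forall a,
    (fnorm (convolution a f g) <= \sum_(p <- s) fnorm (a p.1) * fnorm (f p.2))%R.
Proof.
move=> ff; exists (fset_set (conv_pairs f g)) => a; rewrite convolutionE //.
apply: le_trans (fnorm_sum _ _) _; rewrite !big_seq.
by apply: ler_sum => p /(mem_conv_pairs ff)[cp pg]; exact: fnorm_fmul.
Qed.

(** Settles the case [0 / 0]: here [f] vanishes identically. *)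
Lemma norm2_eq0_convolution a f : finitely_supported rho f -> norm2 f = 0 ->
  norm2 (convolution a f) = 0.
Proof.
move=> ff f0; apply: norm2_eq0 => g.
have fz h : f h = 0%R.
  apply/fnorm0_eq0/eqP; rewrite eq_le fnorm_ge0 andbT.
  by have := fnorm_le_norm2 f h; rewrite f0 lee_fin.
rewrite convolutionE // big_seq big1 // => p /(mem_conv_pairs ff)[cp pg].
by rewrite fz fmul0r.
Qed.

Lemma normb_ub a f : finitely_supported rho f ->
  norm2 (convolution a f) / norm2 f <= normb a.
Proof. by move=> ff; apply: ereal_sup_ubound; exists f. Qed.

Lemma normb_le a (M : \bar R) :
  (forall f, finitely_supported rho f ->
    norm2 (convolution a f) / norm2 f <= M) -> normb a <= M.
Proof. by move=> H; apply: ge_ereal_sup => _ [f ff <-]; exact: H. Qed.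

Lemma finitely_supported0 : finitely_supported rho 0%R.
Proof.
rewrite /finitely_supported /= (_ : supp _ = set0) //.
by rewrite -subset0 => g.
Qed.

Lemma normb_ge0 a : 0 <= normb a.
Proof.
apply: le_trans (normb_ub a finitely_supported0).
by rewrite mule_ge0 ?inve_ge0 ?norm2_ge0.
Qed.

Lemma normbD a b : normb (a + b)%R <= normb a + normb b.
Proof.
apply: normb_le => f ff; rewrite convolutionDl //.
apply: le_trans (_ : (norm2 (convolution a f) + norm2 (convolution b f)) / norm2 f <= _).
  by rewrite lee_wpmul2r ?inve_ge0 ?norm2_ge0 // norm2D.
by rewrite ge0_muleDl ?norm2_ge0 // leeD // normb_ub.
Qed.

Lemma normbZ_le (l : R[i]) a : normb (l *: a)%R <= (complex.Re `|l|)%:E * normb a.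
Proof.
have l0 : 0 <= (complex.Re `|l|)%:E by rewrite lee_fin Re_norm_ge0.
apply: normb_le => f ff; rewrite convolutionZl //.
apply: le_trans (_ : ((complex.Re `|l|)%:E * norm2 (convolution a f)) / norm2 f <= _).
  by rewrite lee_wpmul2r ?inve_ge0 ?norm2_ge0 // norm2Z_le.
by rewrite -muleA lee_wpmul2l // normb_ub.
Qed.

(* With [h = b^* b] one has [(b h)^* (b h) = h^3], and [|h|^4 = |h^4| <= |h| |h^3|]. *)
Lemma bnorm_cube_le (b : tot rho) :
  (bnorm b ^+ 3 <= bnorm (bmul b (bmul (bstar b) b)))%R.
Proof.
set h := bmul (bstar b) b; set c := bmul b h; set s := src (proj b).
have us : units G s by exists (proj b).
have db : bdef (bstar b) b.
  by rewrite /bdef (fell_proj_star FA); exact: composable_inv_l.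
have ph : proj h = s by rewrite (fell_proj_mul FA) // (fell_proj_star FA).
have sh : bstar h = h.
  by have [_ ->] := star_semigroupoidM SSA db; rewrite (star_semigroupoidK SSA).
have dbh : bdef b h by rewrite /bdef ph; exact: composable_src.
have dhh : bdef h h by rewrite /bdef ph; exact: unit_composable.
have phh : proj (bmul h h) = s by rewrite (fell_proj_mul FA) // ph unit_mul.
have [dhb cE] := star_semigroupoidM SSA dbh; rewrite sh -/c in dhb cE.
have mulA := semigroupoid_mulA (star_semigroupoid SSA).
have dc : bdef (bmul h (bstar b)) c.
  rewrite -cE /bdef (fell_proj_star FA); exact: composable_inv_l.
have ccE : bmul (bstar c) c = bmul h (bmul h h).
  by rewrite cE mulA // -(mulA (bstar b) b h).
have dhhh : bdef h (bmul h h) by rewrite /bdef ph phh; exact: unit_composable.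
have hh : (bnorm h ^+ 2 = bnorm (bmul h h))%R.
  by rewrite -(fell_norm_star_mul FA) sh.
have shh : bstar (bmul h h) = bmul h h.
  by have [_ ->] := star_semigroupoidM SSA dhh; rewrite sh.
have H : (bnorm h ^+ 4 <= bnorm h * bnorm c ^+ 2)%R.
  rewrite (_ : 4%N = (2 * 2)%N) // exprM hh -(fell_norm_star_mul FA) shh.
  rewrite mulA //; last by rewrite /bdef phh; exact: unit_composable.
  rewrite -(fell_norm_star_mul FA c) ccE; apply: (fell_norm_mul FA).
  by rewrite /bdef (fell_proj_mul FA) // ph phh unit_mul //; exact: unit_composable.
have n0 : (0 <= bnorm b)%R by exact: fnorm_ge0.
have [->|nN0] := eqVneq (bnorm b) 0%R; first by rewrite expr0n; exact: fnorm_ge0.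
have n1 : (0 < bnorm b ^+ 2)%R by rewrite exprn_gt0 // lt_def nN0.
(* With [n = bnorm b] and [bnorm h = n^2], [H] reads [n^8 <= n^2 |c|^2]; cancelling [n^2] gives the
   square of the goal. *)
rewrite (fell_norm_star_mul FA) in H.
rewrite -ler_sqr ?nnegrE ?exprn_ge0 //; last exact: fnorm_ge0.
rewrite -(ler_pM2l n1); apply: le_trans H.
by rewrite -!exprM -exprD.
Qed.

(** The fibre over [s] may lack a unit, so the test section takes the value [a(g)^* a(g)] there. Its
    norm is [n^2], while [bnorm_cube_le] gives the convolution norm at least [n^3] at [g]. *)
Lemma fnorm_le_normb a g : (fnorm (a g))%:E <= normb a.
Proof.
have [->|n0] := eqVneq (fnorm (a g)) 0%R; first exact: normb_ge0.
have n1 : (0 < fnorm (a g))%R by rewrite lt_def n0 fnorm_ge0.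
set n := fnorm (a g) in n0 n1 *; pose s := src g.
pose b0 := bmul (bstar (inc (a g))) (inc (a g)).
have pb0 : proj b0 = s.
  rewrite (fell_proj_mul FA) ?(fell_proj_star FA) ?proj_inc //.
  by rewrite /bdef (fell_proj_star FA); exact: composable_inv_l.
pose f : sections rho := fun h => if h == s then coord h b0 else 0%R.
have fs : f s = coord s b0 by rewrite /f eqxx.
have nfs : (fnorm (f s) = n ^+ 2)%R by rewrite fs fnorm_finner.
have f0 h : h <> s -> f h = 0%R by move=> /eqP/negPf hs; rewrite /f hs.
have ff : finitely_supported rho f.
  apply: (sub_finite_set _ (finite_set1 s)) => h /= fh; apply: contrapT => hs.
  by apply: fh; exact: f0.
have f2 : norm2 f = (n ^+ 2)%:E.
  apply/eqP; rewrite eq_le -{2}nfs fnorm_le_norm2 andbT.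
  apply: norm2_le => [|x F ux Fx]; first by rewrite lee_fin sqr_ge0.
  rewrite lee_fin; apply: le_trans (norm2_partial_le_sum Fx f) _.
  have [sF|sF] := boolP (s \in fset_set F); last first.
    rewrite big_seq big1 ?sqr_ge0 // => h hF; rewrite f0 ?fnorm0 // => hs.
    by rewrite -hs hF in sF.
  rewrite (bigD1_seq s) ?fset_uniq // nfs big1 => [|h /eqP hs].
    by rewrite /= addr0.
  by rewrite f0 // fnorm0.
(* Since [f] lives at [s], the factorization [g = g s] is the only one that contributes. *)
have cE : convolution a f g = fmul g (a g) (f s).
  transitivity (\sum_(p \in [set (g, s)]) fmul g (a p.1) (f p.2))%R.
    apply/esym/fsbig_widen.
      by move=> _ ->; split; [exact: composable_src|exact: gmul_src].
    move=> [p1 p2] /= [[cp pg] np]; rewrite -[LHS]/(fmul g (a p1) (f p2)).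
    rewrite f0 ?fmul0r // => p2s; apply: np; rewrite p2s; congr pair.
    by rewrite -pg p2s -{1}(gmul_src p1) /src cp p2s rng_src.
  by rewrite fsbig_set1.
apply: le_trans (normb_ub a ff); rewrite f2 inver gt_eqF ?exprn_gt0 //.
apply: le_trans (_ : (fnorm (convolution a f g))%:E * ((n ^+ 2)^-1)%:E <= _).
  rewrite -EFinM lee_fin ler_pdivlMr ?exprn_gt0 // -exprS cE.
  have := bnorm_cube_le (inc (a g)); rewrite bnorm_inc -/b0 -/n.
  move=> /le_trans; apply.
  rewrite -(bnorm_inc (fmul g _ _)) inc_fmul ?fs ?inc_coord //.
    exact: composable_src.
  exact: gmul_src.
by rewrite lee_wpmul2r ?fnorm_le_norm2 // lee_fin invr_ge0 sqr_ge0.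
Qed.

End Norms.

(** * Completeness *)


Section BoundedSections.
Context (R : realType) (G : etaleGroupoid) (rho : fellBundle R G).
Implicit Types (a b c w f : sections rho) (g h x : G).

(** Balls of [normb] are closed under pointwise approximation: for fixed [f] and [F], the partial
    norm of the convolution depends on finitely many values of [c], where [w] can stand in for
    [c]. *)
Lemma normb_le_approx c (e : R) :
  (forall (s : seq G) (d : R), 0 < d -> exists w,
    (normb w <= e%:E)%E /\ forall g, g \in s -> fnorm (c g - w g) <= d) ->
  (normb c <= e%:E)%E.
Proof.
move=> H; apply: normb_le => f ff.
have e0 : 0 <= e.
  by have [w [we _]] := H [::] 1 ltr01; rewrite -lee_fin (le_trans (normb_ge0 w)).
have := norm2_ge0 f; case E : (norm2 f) => [r| |] // r0; last first.
  (* The inverse of [+oo] is [0], so the quotient vanishes. *)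
  by rewrite invey mule0 lee_fin.
have [rE|rN0] := eqVneq r 0.
  by rewrite norm2_eq0_convolution ?mul0e ?lee_fin // E rE.
have r1 : 0 < r by rewrite lt_def rN0 -lee_fin.
have convE w : (normb w <= e%:E)%E -> (norm2 (convolution w f) <= (e * r)%:E)%E.
  move=> /(le_trans (normb_ub w ff)); rewrite E inver (negPf rN0).
  by rewrite lee_pdivrMr // -EFinM.
rewrite inver (negPf rN0) lee_pdivrMr // -EFinM.
apply: norm2_le => [|x F ux Fx]; first by rewrite lee_fin mulr_ge0 // ltW.
rewrite lee_fin; apply/ler_addgt0Pr => d d0.
have [L HL] := choice (fun g => fnorm_convolution_le g ff).
(* A uniform error [d'] in the values of [c] changes the partial norm by at most [d' * K]; dividing
   by [K + 1] avoids a zero denominator. *)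
pose K := \sum_(g <- fset_set F) \sum_(p <- L g) fnorm (f p.2).
have K0 : 0 <= K by do 2 (apply: sumr_ge0 => ? _); exact: fnorm_ge0.
have K1 : 0 < K + 1 by rewrite ltr_wpDl.
pose d' := d / (K + 1).
have [w [/convE we Hw]] :=
  H (flatten [seq map fst (L g) | g <- fset_set F]) d' (divr_gt0 d0 K1).
have -> : convolution c f = convolution w f + convolution (c - w) f.
  by rewrite -convolutionDl // addrC subrK.
apply: le_trans (norm2_partialD ux Fx _ _) _; apply: lerD.
  by rewrite -lee_fin (le_trans (norm2_partial_le _ ux Fx)).
apply: le_trans (norm2_partial_le_sum Fx _) _.
apply: le_trans (_ : d' * K <= _); last first.
  by rewrite /d' mulrAC ler_pdivrMr // ler_pM2l // lerDl.
rewrite /K mulr_sumr !big_seq; apply: ler_sum => g gF.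
apply: le_trans (HL g _) _; rewrite mulr_sumr !big_seq; apply: ler_sum => p pL.
apply: ler_wpM2r; first exact: fnorm_ge0.
apply: Hw; apply/flattenP; exists (map fst (L g)); first exact: map_f.
exact: map_f.
Qed.

Definition bounded_pred : {pred sections rho} := fun a => `[< (normb a < +oo)%E >].

Lemma bounded_predP a : reflect (normb a < +oo)%E (a \in bounded_pred).
Proof. exact: asboolP. Qed.

Lemma normbZ_lty (l : R[i]) a : (normb a < +oo -> normb (l *: a) < +oo)%E.
Proof.
move=> ay; apply: le_lt_trans (normbZ_le l a) _.
have : normb a \is a fin_num by rewrite ge0_fin_numE // normb_ge0.
by case: (normb a) => // r _; rewrite -EFinM ltry.
Qed.

Lemma bounded_submod_closed : submod_closed bounded_pred.
Proof.
split=> [|l a b /bounded_predP ay /bounded_predP by_]; apply/bounded_predP.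
  rewrite -(scale0r (0 : sections rho)); apply: le_lt_trans (normbZ_le 0 0) _.
  by rewrite normr0 mul0e ltry.
exact: le_lt_trans (normbD _ _) (lte_add_pinfty (normbZ_lty l ay) by_).
Qed.

HB.instance Definition _ := GRing.isSubmodClosed.Build R[i] (sections rho)
  bounded_pred bounded_submod_closed.

End BoundedSections.

Arguments bounded_pred {R G} rho _.

Definition boundedSection (R : realType) (G : etaleGroupoid)
    (rho : fellBundle R G) : Type :=
  {a : sections rho | a \in bounded_pred rho}.

(** * The complete normed space of bounded sections *)

Section BoundedSectionsNorm.
Context (R : realType) (G : etaleGroupoid) (rho : fellBundle R G).
Local Notation V := (boundedSection rho).

HB.instance Definition _ := SubType.on V.
HB.instance Definition _ := [Choice of V by <:].
HB.instance Definition _ := [SubChoice_isSubLmodule of V by <:].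

Let vfine (v : V) : R := fine (normb (\val v)).

Let vnorm (v : V) : R[i] := (vfine v)%:C.

Let normb_bounded (v : V) : normb (\val v) = (vfine v)%:E.
Proof.
rewrite /vfine fineK // ge0_fin_numE ?normb_ge0 //; exact/bounded_predP/(valP v).
Qed.

Let vnormD (u v : V) : vnorm (u + v) <= vnorm u + vnorm v.
Proof.
have := normbD (\val u) (\val v); rewrite -[(_ + _)%R]/(\val (u + v)).
rewrite !normb_bounded -EFinD lee_fin => H.
by rewrite /vnorm -rmorphD lecR.
Qed.

Let vnormZ_le (l : R[i]) (v : V) : vnorm (l *: v) <= `|l| * vnorm v.
Proof.
have := normbZ_le l (\val v); rewrite -[l *: \val v]/(\val (l *: v)).
rewrite !normb_bounded -EFinM lee_fin => H.
by rewrite /vnorm -(RRe_real (normr_real l)) -rmorphM lecR.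
Qed.

Let vnorm_ge0 (v : V) : 0 <= vnorm v.
Proof. by rewrite ler0c fine_ge0 // normb_ge0. Qed.

Let vnormZ (l : R[i]) (v : V) : vnorm (l *: v) = `|l| * vnorm v.
Proof.
apply/le_anti; rewrite vnormZ_le /=.
have [->|l0] := eqVneq l 0; first by rewrite normr0 mul0r vnorm_ge0.
rewrite -ler_pdivlMl ?normr_gt0 // -normfV.
rewrite -[in leLHS](scale1r v) -(mulVf l0) -scalerA; exact: vnormZ_le.
Qed.

Let fnorm_le_vnorm (v : V) (g : G) : `|(\val v : sections rho) g| <= vnorm v.
Proof.
rewrite normrE_fnorm lecR -lee_fin -normb_bounded; exact: fnorm_le_normb.
Qed.

Let vnorm_eq0 (v : V) : vnorm v = 0 -> v = 0.
Proof.
move=> v0; apply: val_inj; apply: functional_extensionality_dep => g.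
by apply/eqP; rewrite -normr_le0 -v0 fnorm_le_vnorm.
Qed.

HB.instance Definition _ :=
  Lmodule_isNormed.Build R[i] V vnormD vnormZ vnorm_eq0.

Lemma normE_normb (v : V) : normb (\val v) = (complex.Re `|v|)%:E.
Proof. exact: normb_bounded. Qed.

Let bounded_complete (F : set_system V) : ProperFilter F -> cauchy F -> cvg F.
Proof.
move=> FF /cauchyP Fc.
pose ev g (v : V) : fib rho g := (\val v : sections rho) g.
have evB g u v : `|ev g u - ev g v| <= `|u - v|.
  exact: (fnorm_le_vnorm (u - v) g).
have ev_cvg g : cvg (ev g @ F).
  apply: cauchy_cvg; apply: cauchy_exP => e e0; have [v Fv] := Fc e e0.
  exists (ev g v); suff : F [set u | ball (ev g v) e (ev g u)] by [].
  apply: filterS Fv => u; rewrite -!ball_normE /=; exact: le_lt_trans (evB g v u).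
pose a : sections rho := fun g => lim (ev g @ F).
(* Convergence is uniform on a finite set of points, which is what [normb_le_approx] asks for. *)
have near_a (s : seq G) (d : R) : 0 < d ->
    F [set u | forall g, g \in s -> fnorm (a g - ev g u) <= d].
  move=> d0; elim: s => [|g s IH]; first exact: filterS filterT.
  have := ev_cvg g => /cvg_ballP /(_ d%:C); rewrite ltcR => /(_ d0) H.
  apply: filterS (filterI H IH) => u [+ Hu] h.
  rewrite -ball_normE /= normrE_fnorm ltcR => gu.
  by rewrite inE => /predU1P[->|/Hu//]; exact: ltW.
(* The sections [u - v] with [u] in the ball have norm at most [e] and approximate [a - v] at any
   finite set of points. Boundedness of [a] is still open, hence the use of [normb] on plain
   sections. *)
have close (v : V) (e : R) : F (ball v e%:C) -> (normb (a - \val v)%R <= e%:E)%E.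
  move=> Fv; apply: normb_le_approx => s d d0.
  have [u [vu Hu]] := filter_ex (filterI Fv (near_a s d d0)).
  exists (\val (u - v)); split.
    rewrite normE_normb lee_fin; move: vu.
    by rewrite -ball_normE /= distrC => /ltW; rewrite lecE => /andP[].
  move=> g gs; apply: le_trans (Hu g gs).
  have -> : (a - \val v) g - (\val (u - v) : sections rho) g =
      (a g - ev g v) - (ev g u - ev g v) by [].
  by rewrite opprB addrA subrK.
have ay : a \in bounded_pred rho.
  have [v Fv] := Fc 1 ltr01; have := close v 1 Fv => H.
  apply/bounded_predP; rewrite -(subrK (\val v) a).
  apply: le_lt_trans (normbD _ _) _; rewrite lte_add_pinfty //.
    exact: le_lt_trans H (ltry _).
  exact/bounded_predP/(valP v).
apply/cvg_ex; exists (Sub a ay : V); apply/cvg_ballP => e e0.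
(* Radii are complex scalars; a positive one is real. *)
have [r rE] : exists r, e = r%:C.
  by exists (complex.Re e); rewrite RRe_real // gtr0_real.
rewrite rE ltcR in e0 *; have r2 : 0 < r / 2 by rewrite divr_gt0.
(* By [close] the limit is at distance at most [r / 2] from [v], and [u] is strictly closer than
   [r / 2] to [v]. *)
have [v Fv] := Fc (r / 2)%:C (etrans (ltcR _ _) r2).
apply: filterS (Fv) => u; rewrite -!ball_normE /= => vu.
set z : V := Sub a ay; rewrite -(subrK v z) -addrA.
apply: le_lt_trans (ler_normD _ _) _; rewrite [r]splitr rmorphD.
apply: ler_ltD vu; rewrite -[leLHS]RRe_real ?normr_real // lecR -lee_fin.
by rewrite -normE_normb raddfB; exact: close.
Qed.

HB.instance Definition _ := Uniform_isComplete.Build V bounded_complete.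

End BoundedSectionsNorm.

Local Open Scope ereal_scope.

Theorem proposition2p13 (R : realType) (G : etaleGroupoid)
    (rho : fellBundle R G) :
  is_banach_subspace [set a : sections rho | normb a < +oo] (@normb R G rho).
Proof.
exists (boundedSection rho), (\val : {linear boundedSection rho -> sections rho}).
split; [exact: val_inj| |exact: normE_normb].
apply/seteqP; split=> [_ [v _ <-]|a /= ay]; first exact/bounded_predP/(valP v).
by exists (Sub a (introT (bounded_predP a) ay)).
Qed.
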